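(* Let $n\ge 1$, let $T$ be a noncrossing tree on the vertex set $[n+1]$, and let $T_1,\ldots,T_k$ be the noncrossing alternating spanning trees of the transitive closure $\overline{T}$. Then the root polytopes $\mathcal{P}(T_1),\ldots,\mathcal{P}(T_k)$ are $n$-dimensional simplices with disjoint interiors whose union is $\mathcal{P}(T)$. Furthermore, $$\mathrm{vol}\,\mathcal{P}(T)=f_T\,\frac{1}{n!},$$ where $f_T$ denotes the number of noncrossing alternating spanning trees of $\overline{T}$.
   Context: $[m]=\{1,\ldots,m\}$. Graphs have vertex set $[n+1]$, and an edge joining $i<j$ is written $(i,j)$. A graph $G$ on $[n+1]$ is noncrossing if there are no vertices $i<j<k<l$ such that $(i,k)$ and $(j,l)$ are edges of $G$. It is alternating if there are no vertices $i<j<k$ such that $(i,j)$ and $(j,k)$ are edges of $G$. The transitive closure $\overline{G}$ is the graph on $[n+1]$ whose edges are all $(i,j)$ for which there are edges $(i,i_1),(i_1,i_2),\ldots,(i_r,j)$ of $G$ with $i<i_1<\cdots<i_r<j$ (the edges of $G$ themselves, $r=0$, are included). A spanning tree of $\overline{T}$ is a tree with vertex set $[n+1]$ all of whose edges are edges of $\overline{T}$. Let $e_1,\ldots,e_{n+1}$ be the coordinate vectors of $\mathbb{R}^{n+1}$. The full root polytope $\mathcal{P}(A_n^+)$ is the convex hull of the origin and the points $e_i-e_j$, $1\le i<j\le n+1$. For a graph $G$ on $[n+1]$, $\mathcal{C}(G)$ is the cone of nonnegative linear combinations of the vectors $e_i-e_j$ with $(i,j)\in E(G)$, $i<j$, and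 the root polytope of $G$ is $\mathcal{P}(G)=\mathcal{P}(A_n^+)\cap\mathcal{C}(G)$. Interiors are relative interiors. Volume is $n$-dimensional volume in the hyperplane $\{x: x_1+\cdots+x_{n+1}=0\}$, normalized so that a fundamental parallelepiped of the lattice $\mathbb{Z}^{n+1}\cap\{x:x_1+\cdots+x_{n+1}=0\}$ has volume $1$. *)

(* Defs.v *)
From HB Require Import structures.
From mathcomp Require Import all_boot all_order all_algebra.
From mathcomp Require Import all_classical all_reals all_analysis.

Set Implicit Arguments.
Unset Strict Implicit.
Unset Printing Implicit Defensive.

Import Order.TTheory GRing.Theory Num.Theory.
Import numFieldNormedType.Exports.

Local Open Scope classical_set_scope.
Local Open Scope ring_scope.

Section lebesgue_tuple.
Variable R : realType.
Local Notation rT := (measurableTypeR R).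
Local Open Scope ereal_scope.

Definition cons_pair n (p : rT * n.-tuple rT) : n.+1.-tuple rT :=
  [tuple of p.1 :: p.2].

Lemma measurable_cons_pair n : measurable_fun setT (@cons_pair n).
Proof. by apply: measurable_cons. Qed.

Definition uncons_pair n (t : n.+1.-tuple rT) : rT * n.-tuple rT :=
  (thead t, [tuple of behead t]).

Lemma measurable_uncons_pair n : measurable_fun setT (@uncons_pair n).
Proof.
by apply/measurable_fun_pairP; split;
  [exact: measurable_tnth|exact: measurable_behead].
Qed.

Lemma cons_pairK n : cancel (@cons_pair n) (@uncons_pair n).
Proof.
by move=> [x t]; rewrite /uncons_pair /cons_pair theadE; congr pair; exact/val_inj.
Qed.

Section step.
Variables (n : nat) (mu : {sigma_finite_measure set (n.-tuple rT) -> \bar R}).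

Definition leb_cons : set (n.+1.-tuple rT) -> \bar R :=
  pushforward (@lebesgue_measure R \x mu) (@cons_pair n).

Let leb_cons0 : leb_cons set0 = 0.
Proof. by rewrite /leb_cons /pushforward preimage_set0 measure0. Qed.

Let leb_cons_ge0 A : 0 <= leb_cons A.
Proof. by rewrite /leb_cons /pushforward; exact: measure_ge0. Qed.

Let leb_cons_sigma_additive : semi_sigma_additive leb_cons.
Proof.
move=> F mF tF mUF; rewrite /leb_cons /pushforward preimage_bigcup.
have mcons A : measurable A -> measurable (@cons_pair n @^-1` A).
  by move=> mA; rewrite -[X in measurable X]setTI; exact: measurable_cons_pair.
apply: measure_semi_sigma_additive => [i||]; first exact: mcons.
  apply/trivIsetP => /= i j _ _ ij; rewrite -preimage_setI.
  by move/trivIsetP : tF => /(_ _ _ _ _ ij) ->//; rewrite preimage_set0.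
by rewrite -preimage_bigcup; exact: mcons.
Qed.

HB.instance Definition _ := isMeasure.Build _ _ _ leb_cons
  leb_cons0 leb_cons_ge0 leb_cons_sigma_additive.

Let leb_cons_sigma_finite : sigma_finite setT leb_cons.
Proof.
have /sigma_finiteP[F [TF ndF Foo]] := sigma_finiteT (@lebesgue_measure R).
have /sigma_finiteP[G [TG ndG Goo]] := sigma_finiteT mu.
exists (fun k => @uncons_pair n @^-1` (F k `*` G k)).
  rewrite -preimage_bigcup; apply/seteqP; split => // t _ /=.
  have : setT (thead t) by []. rewrite TF => -[i _ Fi].
  have : setT [tuple of behead t] by []. rewrite TG => -[j _ Gj].
  exists (maxn i j) => //; split => /=.
    by move: (thead t) Fi; exact/subsetPset/ndF/leq_maxl.
  by move: [tuple of behead t] Gj; exact/subsetPset/ndG/leq_maxr.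
move=> k; have [mF Fk] := Foo k; have [mG Gk] := Goo k; split.
  rewrite -[X in measurable X]setTI.
  by apply: measurable_uncons_pair => //; exact: measurableX.
rewrite /leb_cons /pushforward (_ : _ @^-1` _ = F k `*` G k).
  by rewrite product_measure1E// lte_mul_pinfty// ge0_fin_numE.
by rewrite -comp_preimage (_ : _ \o _ = id) ?preimage_id//; apply/funext => p;
  exact: cons_pairK.
Qed.

HB.instance Definition _ := Measure_isSigmaFinite.Build _ _ _ leb_cons
  leb_cons_sigma_finite.

End step.

(* n-dimensional Lebesgue measure, as an iterated product measure; `leb_box`
   characterizes it. *)
Fixpoint leb n : {sigma_finite_measure set (n.-tuple rT) -> \bar R} :=
  if n is n'.+1 then leb_cons (leb n') else \d_([tuple] : 0.-tuple rT).

Lemma leb_box n (A : 'I_n -> set rT) : (forall i, measurable (A i)) ->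
  leb n [set t | forall i, A i (tnth t i)] = \prod_(i < n) lebesgue_measure (A i).
Proof.
elim: n A => [|n IHn] A mA.
  rewrite big_ord0 /= diracE mem_set//=.
  by move=> [].
rewrite big_ord_recl -IHn => [|i]; last exact: mA.
rewrite /= /leb_cons /pushforward -product_measure1E//; last first.
  rewrite (_ : mkset _ =
      \bigcap_(i in [set: 'I_n]) ((@tnth n rT)^~ i @^-1` A (lift ord0 i))).
    apply: fin_bigcap_measurable => // i _.
    by rewrite -[X in measurable X]setTI; exact: measurable_tnth.
  by apply/seteqP; split => t /= At i; [move=> _; exact: At|exact: (At i)].
congr (_ _); apply/seteqP; split => -[x t] /=.
  move=> At; split=> [|i]; first by have := At ord0; rewrite /cons_pair tnth0.
  by have := At (lift ord0 i); rewrite /cons_pair tnthS.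
move=> [Ax At] i; rewrite /cons_pair.
have [j ->|->] := unliftP ord0 i; last by rewrite tnth0.
by rewrite tnthS; exact: At.
Qed.
End lebesgue_tuple.

(* A graph on [n.+1] is the set of its edges (i, j), i < j, the vertex v of
   [n.+1] being the ordinal of value v.-1. *)
Section graphs.
Variable n : nat.
Local Notation graph := {set 'I_n.+1 * 'I_n.+1}.
Implicit Types G T : graph.

Definition is_graph G : bool :=
  [forall i : 'I_n.+1, forall j : 'I_n.+1, ((i, j) \in G) ==> (i < j)%N].

Definition noncrossing G : bool :=
  [forall i : 'I_n.+1, forall j : 'I_n.+1, forall k : 'I_n.+1, forall l : 'I_n.+1,
    ~~ [&& (i < j)%N, (j < k)%N, (k < l)%N, (i, k) \in G & (j, l) \in G]].

Definition alternating G : bool :=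
  [forall i : 'I_n.+1, forall j : 'I_n.+1, forall k : 'I_n.+1,
    ~~ [&& (i < j)%N, (j < k)%N, (i, j) \in G & (j, k) \in G]].

Definition edge G : rel 'I_n.+1 := fun i j => (i, j) \in G.

Definition adj G : rel 'I_n.+1 := fun i j => edge G i j || edge G j i.

Definition connected_graph G : bool :=
  [forall i : 'I_n.+1, forall j : 'I_n.+1, connect (adj G) i j].

(* A single edge {i, j} already makes [:: i; j] a `ucycle`, hence the bound on
   the size. *)
Definition acyclic G : bool :=
  `[< forall c : seq 'I_n.+1, (2 < size c)%N -> ~ ucycle (adj G) c >].

Definition is_tree G : bool := [&& is_graph G, connected_graph G & acyclic G].

Definition tclosure G : graph :=
  [set e | `[< exists s : seq 'I_n.+1, path (edge G) e.1 (rcons s e.2) >]]%SET.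

Definition spanning_tree G T : bool := is_tree T && (T \subset G).

Definition na_spanning_trees T : {set graph} :=
  [set S | [&& spanning_tree (tclosure T) S, noncrossing S & alternating S]]%SET.

End graphs.

Section convexity.
Variables (R : realType) (m : nat).
Local Notation V := 'rV[R]_m.
Implicit Types P X : set V.

Definition conv_hull X : set V :=
  [set x | exists d (p : 'I_d -> V) (c : 'I_d -> R),
    [/\ forall i, X (p i), forall i, 0 <= c i, \sum_i c i = 1
      & x = \sum_i c i *: p i]].

Definition affine_hull X : set V :=
  [set x | exists d (p : 'I_d -> V) (c : 'I_d -> R),
    [/\ forall i, X (p i), \sum_i c i = 1 & x = \sum_i c i *: p i]].

Definition relint P : set V :=
  [set x | P x /\ \forall y \near x, affine_hull P y -> P y].

Definition affinely_independent d (p : 'I_d -> V) : Prop :=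
  forall c : 'I_d -> R, \sum_i c i = 0 -> \sum_i c i *: p i = 0 ->
  forall i, c i = 0.

Definition is_simplex d P : Prop :=
  exists p : 'I_d.+1 -> V, affinely_independent p /\ P = conv_hull (range p).

End convexity.

Section root_polytopes.
Variables (R : realType) (n : nat).
Local Notation V := 'rV[R]_n.+1.

Definition root (i j : 'I_n.+1) : V := delta_mx 0 i - delta_mx 0 j.

Definition full_root_polytope : set V :=
  conv_hull [set x | x = 0 \/ exists i j : 'I_n.+1, (i < j)%N /\ x = root i j].

Definition root_cone (G : {set 'I_n.+1 * 'I_n.+1}) : set V :=
  [set x | exists c : 'I_n.+1 * 'I_n.+1 -> R,
    (forall e, 0 <= c e) /\ x = \sum_(e in G) c e *: root e.1 e.2].

Definition root_polytope (G : {set 'I_n.+1 * 'I_n.+1}) : set V :=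
  full_root_polytope `&` root_cone G.

(* Coordinates on the hyperplane \sum_i x_i = 0 with respect to the basis
   e_i - e_{n+1}, i <= n, of its lattice of integral points; see
   `chart_hyperplane`, `chart_inj` and `chart_lattice`. *)
Definition chart (t : n.-tuple R) : V :=
  \sum_(i < n) tnth t i *: root (lift ord_max i) ord_max.

Definition vol (P : set V) : \bar R := leb R n (chart @^-1` P).

Lemma chart_coord t i : chart t 0 (lift ord_max i) = tnth t i.
Proof.
have lm (j : 'I_n) : (lift ord_max j == ord_max) = false.
  by rewrite eq_sym (negPf (neq_lift _ _)).
rewrite /chart summxE (bigD1 i)//= big1 => [|j ji].
  by rewrite !mxE/= !eqxx lm subr0 mulr1 addr0.
by rewrite !mxE/= (inj_eq lift_inj) eq_sym (negPf ji) lm subr0 mulr0.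
Qed.

Lemma chart_inj : injective chart.
Proof.
by move=> s t st; apply: eq_from_tnth => i; rewrite -!chart_coord st.
Qed.

Lemma chart_sum t : \sum_i chart t 0 i = 0.
Proof.
have e1 k : \sum_j (delta_mx 0 k : V) 0 j = 1.
  rewrite (bigD1 k)//= big1 => [|j jk]; rewrite mxE ?eqxx ?addr0//.
  by rewrite (negPf jk) andbF.
have r0 k l : \sum_j (root k l : V) 0 j = 0.
  rewrite -[RHS](subrr 1) -{1}(e1 k) -(e1 l) -sumrB.
  by apply: eq_bigr => j _; rewrite /root [LHS]mxE [X in _ + X]mxE.
rewrite /chart (eq_bigr (fun j => \sum_(i < n)
    (tnth t i *: root (lift ord_max i) ord_max) 0 j)).
  rewrite exchange_big/= big1// => i _.
  rewrite (eq_bigr (fun j => tnth t i * root (lift ord_max i) ord_max 0 j)).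
    by rewrite -mulr_sumr r0 mulr0.
  by move=> j _; rewrite [LHS]mxE.
by move=> j _; rewrite summxE.
Qed.

Lemma chart_hyperplane (x : V) : \sum_i x 0 i = 0 <-> range chart x.
Proof.
split=> [x0|[t _ <-]]; last exact: chart_sum.
exists [tuple x 0 (lift ord_max i) | i < n] => //.
set t := [tuple _ | _ < _].
have xE i : chart t 0 (lift ord_max i) = x 0 (lift ord_max i).
  by rewrite chart_coord tnth_mktuple.
apply/rowP => j; have [i ->//|->] := unliftP ord_max j.
move: (chart_sum t) x0; rewrite (bigD1 ord_max)//=
  [in X in _ -> X -> _](bigD1 ord_max)//=.
have -> : \sum_(i < n.+1 | i != ord_max) chart t 0 i =
    \sum_(i < n.+1 | i != ord_max) x 0 i.
  apply: eq_bigr => i ni; have [k ->//|ie] := unliftP ord_max i.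
  by rewrite ie eqxx in ni.
by move=> tS xS; apply: (addIr (\sum_(i < n.+1 | i != ord_max) x 0 i));
  rewrite tS xS.
Qed.

Lemma chart_lattice t :
  (forall i, chart t 0 i \is a Num.int) <-> (forall i, tnth t i \is a Num.int).
Proof.
split=> [ti i|ti j]; first by rewrite -chart_coord.
rewrite /chart summxE rpred_sum// => i _; rewrite !mxE.
by apply: rpredM => //; apply: rpredB; [apply: natr_int|apply: natr_int].
Qed.

End root_polytopes.

Arguments root_polytope R {n} G _.

(* Main.v *)
(* A vector in the root cone has a unique nonnegative expansion with noncrossing
   alternating support: on a shortest edge where two expansions differ,
   conservation of flow at its two endpoints forces two crossing edges. Hence the
   roots of a noncrossing alternating graph are independent and two such cones
   meet only along the span of their common roots.  Conversely, starting from T,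
   the relation (e_i - e_j) + (e_j - e_k) = e_i - e_k rewrites any point of the
   cone into a connected noncrossing alternating graph inside the transitive
   closure; composing the outermost edges at j creates no crossing.
   Such a graph is connected with independent roots, so its incidence matrix is
   square, has an integral inverse, and maps the standard simplex to the root
   polytope preserving volume. *)
Require Import Defs.
From mathcomp Require Import all_boot all_order all_algebra.
From mathcomp Require Import all_classical all_reals all_analysis.
From mathcomp Require Import measurable_realfun ring lra.

Set Implicit Arguments.
Unset Strict Implicit.
Unset Printing Implicit Defensive.

Import Order.TTheory GRing.Theory Num.Theory.
Import numFieldNormedType.Exports.

Local Open Scope classical_set_scope.
Local Open Scope ring_scope.

(** * Linear invariance of Lebesgue measure *)

Section preserving.
Variables (d : measure_display) (X : measurableType d) (R : realType).
Variable mu : {measure set X -> \bar R}.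

(** Measurability is part of the notion because composing two such maps requires the intermediate
    preimage to be measurable. *)
Definition preserving (g : X -> X) : Prop :=
  measurable_fun setT g /\ forall E, measurable E -> mu (g @^-1` E) = mu E.

Lemma preserving_comp (f g : X -> X) :
  preserving f -> preserving g -> preserving (f \o g).
Proof.
move=> [mf pf] [mg pg]; split; first exact: measurableT_comp.
move=> E mE; rewrite comp_preimage pg ?pf//.
by rewrite -[X in measurable X]setTI; exact: mf.
Qed.

End preserving.

(** By induction: the first set meets the union of the others in a finite union of null sets, so the
    overlap term of inclusion-exclusion is 0. *)
Lemma measure_bigsetU_null (R : realType) (d : measure_display) (X : measurableType d)
    (mu : {measure set X -> \bar R}) (I : eqType) (s : seq I) (F : I -> set X) (v : R) :
  uniq s -> (forall i, i \in s -> measurable (F i)) ->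
  (forall i, i \in s -> mu (F i) = v%:E) ->
  (forall i j, i \in s -> j \in s -> i != j -> mu (F i `&` F j) = 0%E) ->
  mu (\big[setU/set0]_(i <- s) F i) = ((size s)%:R * v)%:E.
Proof.
move=> + mF Fv; elim: s mF Fv => [|i s IHs] mF Fv /=.
  by rewrite big_nil measure0 mul0r.
move=> /andP[iNs us] F0.
have mFs j : j \in s -> measurable (F j) by move=> js; apply: mF; rewrite inE js orbT.
have mFi : measurable (F i) by apply: mF; rewrite inE eqxx.
have mU : measurable (\big[setU/set0]_(j <- s) F j).
  by rewrite big_seq; apply: bigsetU_measurable.
have U0 (r : seq I) : {subset r <= s} -> mu (F i `&` \big[setU/set0]_(j <- r) F j) = 0%E.
  elim: r => [|j r IHr] rs; first by rewrite big_nil setI0 measure0.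
  have js : j \in s by apply: rs; rewrite inE eqxx.
  have {}rs : {subset r <= s} by move=> k kr; apply: rs; rewrite inE kr orbT.
  rewrite big_cons setIUr; apply: null_set_setU; last exact: IHr.
  - by apply: measurableI => //; exact: mFs.
  - apply: measurableI => //; rewrite big_seq; apply: bigsetU_measurable => k kr.
    exact/mFs/rs.
  - apply: F0; rewrite ?inE ?eqxx ?js ?orbT//.
    by apply: contraNneq iNs => ->.
rewrite big_cons measureUfinl//=; last by rewrite Fv ?inE ?eqxx// ltry.
rewrite Fv ?inE ?eqxx// IHs// => [|j js|j k js ks jk].
- rewrite U0// oppe0 adde0 -EFinD; congr EFin.
  by rewrite -[X in X + _]mul1r -mulrDl addrC natr1.
- by apply: Fv; rewrite inE js orbT.
- by apply: F0; rewrite ?inE ?js ?ks ?orbT.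
Qed.

Section leb_linear.
Variable R : realType.
Local Notation rT := (measurableTypeR R).

(** The pushed-forward measure gives half-open intervals their length, and these values determine
    Lebesgue measure. *)
Lemma lebesgue_isometry (s a : R) : s = 1 \/ s = -1 ->
  preserving (@lebesgue_measure R) (fun x : rT => s * x + a).
Proof.
move=> s1.
have mf : measurable_fun [set: rT] (fun x : rT => s * x + a : rT).
  by apply: measurable_funD => //; exact: measurable_funM.
split=> // E mE.
rewrite -[LHS]/(pushforward (@lebesgue_measure R) (fun x : rT => s * x + a : rT) E).
apply/esym; apply: lebesgue_measure_unique mE.
move=> I; rewrite /ocitv => -[[b c]] /= _ <-.
rewrite /pushforward; case: s1 => -> .
  rewrite [X in _ = lebesgue_measure X](_ : _ = `]b - a, c - a]%classic); last first.
    by apply/seteqP; split => x /=; rewrite !in_itv/= => /andP[? ?]; lra.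
  rewrite !lebesgue_measure_itv/= !lte_fin ltrD2r; case: ifP => // _.
  by rewrite -!EFinD; congr EFin; ring.
(* The reflection exchanges the open and the closed endpoint, which does not affect the length. *)
rewrite [X in _ = lebesgue_measure X](_ : _ = `[a - c, a - b[%classic); last first.
  by apply/seteqP; split => x /=; rewrite !in_itv/= => /andP[? ?]; lra.
rewrite !lebesgue_measure_itv/= !lte_fin ltrD2l ltrN2; case: ifP => // _.
by rewrite -!EFinD; congr EFin; ring.
Qed.

(** A map that fixes the first coordinate acts on each slice over it; integrating the slice measures
    gives the claim. *)
Lemma leb_fiberwise n (g : n.+1.-tuple rT -> n.+1.-tuple rT)
    (h : rT -> n.-tuple rT -> n.-tuple rT) :
  measurable_fun setT g ->
  (forall x t, g (cons_pair (x, t)) = cons_pair (x, h x t)) ->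
  (forall x, preserving (leb R n) (h x)) ->
  preserving (leb R n.+1) g.
Proof.
move=> mg gh ph; split=> // E mE /=; rewrite /leb_cons /pushforward.
rewrite -comp_preimage.
have mE' : measurable (@cons_pair R n @^-1` E).
  by rewrite -[X in measurable X]setTI; exact: measurable_cons_pair.
rewrite /product_measure1; apply: eq_integral => x _ /=.
have [_ phx] := ph x.
rewrite -[RHS]phx; last exact: measurable_xsection.
congr (leb R n _); apply/seteqP; split => t;
  by rewrite /xsection/= !in_setE/= !gh ?in_setE.
Qed.

(** Here the slices run along the first coordinate, where the map is an isometry of the line. *)
Lemma leb_cofiberwise n (g : n.+1.-tuple rT -> n.+1.-tuple rT)
    (s : R) (h : n.-tuple rT -> rT) :
  s = 1 \/ s = -1 ->
  measurable_fun setT g ->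
  (forall x t, g (cons_pair (x, t)) = cons_pair (s * x + h t, t)) ->
  preserving (leb R n.+1) g.
Proof.
move=> s1 mg gh; split=> // E mE /=; rewrite /leb_cons /pushforward.
rewrite -comp_preimage.
have mE' : measurable (@cons_pair R n @^-1` E).
  by rewrite -[X in measurable X]setTI; exact: measurable_cons_pair.
have mgE : measurable ((g \o @cons_pair R n) @^-1` E).
  rewrite -[X in measurable X]setTI; apply: measurableT_comp => //.
  exact: measurable_cons_pair.
(* The measure is built from slices over the first coordinate; uniqueness of the product measure
   permits slicing in the other direction. *)
have eq12 (A : set (rT * n.-tuple rT)) : measurable A ->
    (@lebesgue_measure R \x leb R n)%E A = (@lebesgue_measure R \x^ leb R n)%E A.
  apply: product_measure_unique => B C mB mC.
  exact: product_measure2E.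
rewrite [LHS]eq12// [RHS]eq12//.
rewrite /product_measure2; apply: eq_integral => t _ /=.
have [_ pht] := lebesgue_isometry (h t) s1.
rewrite -[RHS]pht; last exact: measurable_ysection.
congr (lebesgue_measure _); apply/seteqP; split => x;
  by rewrite /ysection/= !in_setE/= !gh ?in_setE.
Qed.

(** Tuples act as row vectors multiplied on the right by [A], hence the reversed order in
    [lin_mul]. *)
Definition lin n (A : 'M[R]_n) (t : n.-tuple rT) : n.-tuple rT :=
  [tuple \sum_i tnth t i * A i j | j < n].

Lemma measurable_lin n (A : 'M[R]_n) : measurable_fun setT (lin A).
Proof.
apply/measurable_fun_tnthP => j.
rewrite (_ : _ \o _ = fun t => \sum_i tnth t i * A i j); last first.
  by apply/funext => t /=; rewrite tnth_mktuple.
apply: measurable_sum => i; apply: measurable_funM => //.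
exact: measurable_tnth.
Qed.

Lemma lin_mul n (A B : 'M[R]_n) : lin (A *m B) = lin B \o lin A.
Proof.
apply/funext => t; apply: eq_from_tnth => j; rewrite !tnth_mktuple.
under eq_bigr do rewrite mxE mulr_sumr.
rewrite exchange_big; apply: eq_bigr => k _; rewrite tnth_mktuple mulr_suml.
by apply: eq_bigr => i _; rewrite mulrA.
Qed.

Definition shift_tuple n (v t : n.-tuple rT) : n.-tuple rT :=
  [tuple tnth t j + tnth v j | j < n].

Lemma measurable_shift_tuple n (v : n.-tuple R) : measurable_fun setT (shift_tuple v).
Proof.
apply/measurable_fun_tnthP => j.
rewrite (_ : _ \o _ = fun t => tnth t j + tnth v j); last first.
  by apply/funext => t /=; rewrite tnth_mktuple.
by apply: measurable_funD => //; exact: measurable_tnth.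
Qed.

Lemma preserving_tuple0 (g : 0.-tuple rT -> 0.-tuple rT) : preserving (leb R 0) g.
Proof.
have -> : g = id by apply/funext => t; rewrite [g t]tuple0 [t]tuple0.
by split.
Qed.

(** The translation splits into one of the first coordinate, handled by [leb_cofiberwise], and one
    of the other coordinates, handled by induction on slices. *)
Lemma leb_translation n (v : n.-tuple R) : preserving (leb R n) (shift_tuple v).
Proof.
elim: n v => [|n IHn] v; first exact: preserving_tuple0.
pose v0 : n.+1.-tuple R := [tuple if j == ord0 then tnth v ord0 else 0 | j < n.+1].
pose v1 : n.+1.-tuple R := [tuple if j == ord0 then 0 else tnth v j | j < n.+1].
have -> : shift_tuple v = shift_tuple v0 \o shift_tuple v1.
  apply/funext => t; apply: eq_from_tnth => j; rewrite !tnth_mktuple.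
  by case: eqP => [->|_]; rewrite ?addr0.
apply: preserving_comp.
  apply: (@leb_cofiberwise n _ 1 (fun _ => tnth v ord0)) => //.
  - by left.
  - exact: measurable_shift_tuple.
  - move=> x t; apply: eq_from_tnth => j; rewrite !tnth_mktuple.
    have [k ->|->] := unliftP ord0 j; last by rewrite !tnth0 eqxx mul1r.
    by rewrite !tnthS eq_sym (negPf (neq_lift _ _)) addr0.
apply: (@leb_fiberwise n _
  (fun x t => shift_tuple [tuple of behead v] t)) => //.
- exact: measurable_shift_tuple.
- move=> x t; apply: eq_from_tnth => j; rewrite !tnth_mktuple.
  have [k ->|->] := unliftP ord0 j; last by rewrite !tnth0 eqxx addr0.
  rewrite !tnthS eq_sym (negPf (neq_lift _ _)) tnth_mktuple; congr (_ + _).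
  by rewrite [in LHS](tuple_eta v) tnthS.
Qed.

(** The right-hand side fits [leb_fiberwise] when [a] is 1 and [c] is 0, and [leb_cofiberwise] when
    [a] is a sign, [b] is 0 and [D] is the identity. *)
Lemma lin_block n (a : 'M[R]_1) (b : 'M[R]_(1, n)) (c : 'M[R]_(n, 1)) (D : 'M[R]_n)
    (x : R) (t : n.-tuple R) :
  lin (block_mx a b c D : 'M[R]_n.+1) (cons_pair (x, t)) =
  cons_pair (x * a 0 0 + \sum_i tnth t i * c i 0,
             shift_tuple [tuple x * b 0 j | j < n] (lin D t)).
Proof.
have lS (i : 'I_n) : lift ord0 i = rshift 1 i by exact/val_inj.
have l0 : ord0 = lshift n ord0 :> 'I_(1 + n) by exact/val_inj.
have bul : (block_mx a b c D : 'M[R]_n.+1) ord0 ord0 = a 0 0.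
  by rewrite -(block_mxEul a b c D) -l0.
have bur k : (block_mx a b c D : 'M[R]_n.+1) ord0 (lift ord0 k) = b 0 k.
  by rewrite -(block_mxEur a b c D) -lS -l0.
have bdl i : (block_mx a b c D : 'M[R]_n.+1) (lift ord0 i) ord0 = c i 0.
  by rewrite -(block_mxEdl a b c D) -lS -l0.
have bdr i k : (block_mx a b c D : 'M[R]_n.+1) (lift ord0 i) (lift ord0 k) = D i k.
  by rewrite -(block_mxEdr a b c D) -!lS.
apply: eq_from_tnth => j; rewrite tnth_mktuple.
rewrite big_ord_recl /cons_pair tnth0.
under eq_bigr do rewrite tnthS.
have [k ->|->] := unliftP ord0 j.
  rewrite tnthS !tnth_mktuple bur addrC; congr (_ + _).
  by apply: eq_bigr => i _; rewrite bdr.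
rewrite tnth0 bul; congr (_ + _).
by apply: eq_bigr => i _; rewrite bdl.
Qed.

Lemma lin1 n (t : n.-tuple rT) : lin 1%:M t = t.
Proof.
apply: eq_from_tnth => j; rewrite tnth_mktuple (bigD1 j)//= big1 => [|i ij].
  by rewrite mxE eqxx mulr1 addr0.
by rewrite mxE (negPf ij) mulr0.
Qed.

Lemma leb_lin_ushear n (b : 'M[R]_(1, n)) :
  preserving (leb R n.+1) (lin (block_mx 1%:M b 0 1%:M : 'M[R]_n.+1)).
Proof.
apply: (@leb_fiberwise n _ (fun x => shift_tuple [tuple x * b 0 j | j < n])).
- exact: measurable_lin.
- move=> x t; rewrite lin_block mxE mulr1 big1 ?addr0 ?lin1// => i _.
  by rewrite mxE mulr0.
- by move=> x; exact: leb_translation.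
Qed.

(** The value -1 serves the 1-by-1 matrices, where no shear can change the sign. *)
Lemma leb_lin_lshear n (a : 'M[R]_1) (c : 'M[R]_(n, 1)) :
  a 0 0 = 1 \/ a 0 0 = -1 ->
  preserving (leb R n.+1) (lin (block_mx a 0 c 1%:M : 'M[R]_n.+1)).
Proof.
move=> a1; apply: (@leb_cofiberwise n _ (a 0 0)
  (fun t => \sum_i tnth t i * c i 0)) => //.
  exact: measurable_lin.
move=> x t; rewrite lin_block lin1 mulrC; congr (cons_pair (_, _)).
apply: eq_from_tnth => j; rewrite !tnth_mktuple.
by rewrite mxE mulr0 addr0.
Qed.

Lemma leb_lin_diag n (D : 'M[R]_n) : preserving (leb R n) (lin D) ->
  preserving (leb R n.+1) (lin (block_mx (1%:M : 'M[R]_1) 0 0 D : 'M[R]_n.+1)).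
Proof.
move=> pD; apply: (@leb_fiberwise n _ (fun x => lin D)) => //.
  exact: measurable_lin.
move=> x t; rewrite lin_block mxE mulr1 big1 ?addr0.
  congr (cons_pair (_, _)); apply: eq_from_tnth => j; rewrite tnth_mktuple.
  by rewrite [X in _ + X]tnth_mktuple mxE mulr0 addr0.
by move=> i _; rewrite mxE mulr0.
Qed.

(* Shears bring the upper left entry to 1 and then clear the first row and
   column, so that no rescaling is ever needed. *)
Lemma leb_lin n (A : 'M[R]_n) : `|\det A| = 1 -> preserving (leb R n) (lin A).
Proof.
elim: n A => [|n IHn] A detA; first exact: preserving_tuple0.
move: A detA; change (forall A : 'M[R]_(1 + n), `|\det A| = 1 ->
  preserving (leb R n.+1) (lin (A : 'M[R]_n.+1))).
(* [mulU] and [mulL] are row operations: the opposite shear recovers [A], so invariance may be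
   proved for the sheared matrix instead. *)
have mulU (b : 'M[R]_(1, n)) (A : 'M[R]_(1 + n)) :
    \det (block_mx 1%:M b 0 1%:M *m A) = \det A /\
    (preserving (leb R n.+1) (lin (block_mx 1%:M b 0 1%:M *m A : 'M[R]_n.+1)) ->
    preserving (leb R n.+1) (lin (A : 'M[R]_n.+1))).
  split=> [|pA]; first by rewrite det_mulmx det_ublock !det1 !mul1r.
  have -> : A = block_mx 1%:M (- b) 0 1%:M *m (block_mx 1%:M b 0 1%:M *m A).
    rewrite mulmxA mulmx_block !mul1mx !mulmx1 !mul0mx !mulmx0 !addr0 add0r subrr.
    by rewrite -scalar_mx_block mul1mx.
  by rewrite lin_mul; apply: preserving_comp pA _; exact: leb_lin_ushear.
have mulL (c : 'M[R]_(n, 1)) (A : 'M[R]_(1 + n)) :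
    \det (block_mx 1%:M 0 c 1%:M *m A) = \det A /\
    (preserving (leb R n.+1) (lin (block_mx 1%:M 0 c 1%:M *m A : 'M[R]_n.+1)) ->
    preserving (leb R n.+1) (lin (A : 'M[R]_n.+1))).
  split=> [|pA]; first by rewrite det_mulmx det_lblock !det1 !mul1r.
  have -> : A = block_mx 1%:M 0 (- c) 1%:M *m (block_mx 1%:M 0 c 1%:M *m A).
    rewrite mulmxA mulmx_block !mul1mx !mulmx1 !mul0mx !mulmx0 !addr0 !add0r addNr.
    by rewrite -scalar_mx_block mul1mx.
  rewrite lin_mul; apply: preserving_comp pA _; apply: leb_lin_lshear.
  by left; rewrite mxE.
have pivot1 (A : 'M[R]_(1 + n)) : `|\det A| = 1 -> ulsubmx A = 1%:M ->
    preserving (leb R n.+1) (lin (A : 'M[R]_n.+1)).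
  rewrite -(submxK A); move: (ursubmx A) (dlsubmx A) (drsubmx A) => b c E.
  move=> + A1; rewrite block_mxKul in A1; rewrite A1 => detA.
  have [detL pL] := mulL (- c) (block_mx 1%:M b c E); apply: pL.
  move: detL; rewrite mulmx_block !mul1mx !mulmx1 !mul0mx !addr0 addNr.
  (* [D] is the Schur complement of the corner entry 1; it has the determinant of the original
     matrix, so induction applies to it. *)
  set D := _ + E => detL.
  have -> : block_mx 1%:M b 0 D = block_mx 1%:M 0 0 D *m block_mx 1%:M b 0 1%:M.
    by rewrite mulmx_block !mul1mx !mulmx1 !mul0mx !mulmx0 !addr0 add0r.
  rewrite lin_mul; apply: preserving_comp; first exact: leb_lin_ushear.
  by apply/leb_lin_diag/IHn; rewrite -detA -detL det_ublock det1 mul1r.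
have pivot (A : 'M[R]_(1 + n)) : `|\det A| = 1 -> dlsubmx A != 0 ->
    preserving (leb R n.+1) (lin (A : 'M[R]_n.+1)).
  move=> detA /matrix0Pn[i [k]]; rewrite (ord1 k) => Ai0.
  (* Adds to the first row the multiple of a lower row that turns the corner entry into 1. *)
  pose b : 'M[R]_(1, n) := ((1 - ulsubmx A 0 0) / dlsubmx A i 0) *: delta_mx 0 i.
  have [detU pU] := mulU b A; apply/pU/pivot1; first by rewrite detU.
  rewrite -[in LHS](submxK A) mulmx_block block_mxKul mul1mx.
  apply/matrixP => r s; rewrite !ord1 [LHS]mxE -scalemxAl -rowE [X in _ + X]mxE.
  by rewrite [X in _ + _ * X]mxE mulfVK// [RHS]mxE eqxx addrC subrK.
move=> A detA; have [dl0|] := eqVneq (dlsubmx A) 0; last exact: pivot.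
case: (posnP n) => [n0|n_gt0].
  clear IHn mulU mulL pivot1 pivot; subst n.
  have A_E : A = block_mx (ulsubmx A) 0 (dlsubmx A) 1%:M.
    by rewrite -[LHS]submxK; congr block_mx; apply/matrixP => i [].
  rewrite A_E; apply: leb_lin_lshear; move: detA.
  rewrite A_E block_mxKul det_lblock det1 mulr1 det_mx11 => /eqP.
  by rewrite eqr_norml ler01 andbT => /orP[]/eqP; [left|right].
have ul0 : ulsubmx A 0 0 != 0.
  apply/eqP => ul0; move: detA; rewrite -(submxK A) dl0 det_ublock det_mx11 ul0.
  by rewrite mul0r normr0 => /esym/eqP; rewrite oner_eq0.
(* The first column vanishes below its nonzero corner; adding the first row to all others makes it
   nonzero there. *)
have [detL pL] := mulL (const_mx 1) A; apply/pL/pivot; first by rewrite detL.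
rewrite -[in X in dlsubmx X](submxK A) mulmx_block block_mxKdl dl0 mul1mx addr0.
apply/matrix0Pn; exists (Ordinal n_gt0), 0.
by rewrite mxE big_ord1 mxE mul1r.
Qed.

(** * Volume of the standard simplex *)

Definition corner n (s : R) : set (n.-tuple R) :=
  [set t | (forall i, 0 <= tnth t i) /\ \sum_i tnth t i <= s].
Arguments corner n s _ : clear implicits.

Lemma measurable_corner n s : measurable (corner n s : set (n.-tuple rT)).
Proof.
have -> : corner n s = \bigcap_(i in [set: 'I_n])
    ((@tnth n rT)^~ i @^-1` `[0, +oo[) `&`
    ((fun t => \sum_i tnth t i) @^-1` `]-oo, s]).
  apply/seteqP; split => t /= [t0 ts]; split.
  - by move=> i _ /=; rewrite in_itv/= t0.
  - by rewrite in_itv/=.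
  - by move=> i; have := t0 i I; rewrite /= in_itv/= andbT.
  - by move: ts; rewrite in_itv/=.
apply: measurableI.
  apply: fin_bigcap_measurable => // i _.
  by rewrite -[X in measurable X]setTI; exact: measurable_tnth.
rewrite -[X in measurable X]setTI; apply: measurable_sum => // i.
exact: measurable_tnth.
Qed.

Lemma integral_deriv (p : {poly R}) (a b : R) : a <= b ->
  (\int[@lebesgue_measure R]_(x in `[a, b]) (p^`().[x])%:E = (p.[b] - p.[a])%:E)%E.
Proof.
rewrite le_eqVlt => /predU1P[<-|ab]; first by rewrite set_itv1 integral_set1 subrr.
have cp (q : {poly R}) : continuous (horner q) by exact: continuous_horner.
rewrite (@continuous_FTC2 _ _ (horner p))//.
- by apply: continuous_subspaceT; exact: cp.
- split.
  + by move=> x _; exact: ex_derive.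
  + by apply: cvg_at_right_filter; exact: cp.
  + by apply: cvg_at_left_filter; exact: cp.
- by move=> x _; rewrite derive1E; exact: derive_val.
Qed.

(** The slice at first coordinate [x] is a corner of bound [s - x], so the volume is the integral of
    (s - x)^n / n! over [0, s]; the induction needs [s] to vary. *)
Lemma leb_corner n (s : R) : 0 <= s -> leb R n (corner n s) = (s ^+ n / n`!%:R)%:E.
Proof.
elim: n s => [|n IHn] s s0.
  rewrite /= expr0 fact0 divr1 diracE mem_set//=.
  by split=> [[]//|]; rewrite big_ord0.
rewrite /= /leb_cons /pushforward /product_measure1.
(* An antiderivative of (s - x)^n / n!, in polynomial form so that [integral_deriv] applies. *)
pose p : {poly R} := - (n.+1`!%:R^-1)%:P * (s%:P - 'X) ^+ n.+1.
have nf (m : nat) : (m`!%:R : R) != 0 by rewrite pnatr_eq0 -lt0n fact_gt0.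
have dp x : p^`().[x] = (s - x) ^+ n / n`!%:R.
  rewrite /p derivM derivN derivC oppr0 mul0r add0r deriv_exp derivB derivX derivC.
  rewrite sub0r mulN1r hornerM hornerMn !hornerE factS natrM -mulr_natr.
  by field; rewrite nf/= addrC natr1 pnatr_eq0.
rewrite (_ : (s ^+ n.+1 / n.+1`!%:R) = p.[s] - p.[0]); last first.
  by rewrite /p !hornerE subrr subr0 expr0n/= mulr0 sub0r; field; rewrite nf.
rewrite -integral_deriv// [RHS]integral_mkcond; apply: eq_integral => x _ /=.
rewrite patchE; case: ifPn => [|xs].
  rewrite inE/= in_itv/= => /andP[x0 xs].
  rewrite dp -IHn ?subr_ge0//; congr (leb R n _).
  apply/seteqP; split => t; rewrite /xsection/= in_setE/= /corner/= big_ord_recl.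
    rewrite /cons_pair tnth0 => -[t0 ts]; split.
      by move=> i; have := t0 (lift ord0 i); rewrite tnthS.
    by rewrite lerBrDl; under eq_bigr do rewrite -(tnthS x); exact: ts.
  rewrite /cons_pair tnth0 => -[t0 ts]; split.
    by move=> i; have [k ->|->] := unliftP ord0 i; rewrite ?tnthS ?tnth0.
  by rewrite -lerBrDl; under eq_bigr do rewrite tnthS.
(* For [x] outside [0, s] the slice is empty. *)
rewrite (_ : xsection _ _ = set0) ?measure0//; apply/seteqP; split => // t.
rewrite /xsection/= in_setE/= /corner/= big_ord_recl /cons_pair tnth0 => -[t0 ts].
move/negP : xs; apply; rewrite inE/= in_itv/=.
have := t0 ord0; rewrite tnth0 => -> /=; apply: le_trans ts.
by rewrite lerDl sumr_ge0.
Qed.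

(** The hyperplane is a box one of whose sides is a single point. *)
Lemma leb_hyperplane n (i : 'I_n) : leb R n [set t | tnth t i = 0] = 0%E.
Proof.
pose A (j : 'I_n) : set rT := if j == i then [set 0] else setT.
rewrite (_ : mkset _ = [set t | forall j, A j (tnth t j)]); last first.
  apply/seteqP; split => t /= ti; last by have := ti i; rewrite /A eqxx.
  by move=> j; rewrite /A; case: eqP => [->|].
rewrite leb_box => [|j]; last by rewrite /A; case: eqP.
by rewrite (bigD1 i)//= /A eqxx lebesgue_measure_set1 mul0e.
Qed.

End leb_linear.
Arguments corner {R} n s _.

(** * Noncrossing alternating combinations of roots *)

(** Used for conservation of flow at a vertex: an excess on one edge is compensated by a deficit on
    another. *)
Lemma sum_eq_exists_lt (R : realDomainType) (I : finType) (p q : I -> R) (j : I) :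
  \sum_i p i = \sum_i q i -> q j < p j -> exists i, p i < q i.
Proof.
move=> pq qp; apply: contrapT => /forallNP npq.
have : \sum_i q i < \sum_i p i.
  rewrite (bigD1 j)//= [ltRHS](bigD1 j)//= ltr_leD// ler_sum// => i _.
  by rewrite leNgt; apply/negP/npq.
by rewrite pq ltxx.
Qed.

Section graph_predicates.
Variable n : nat.
Local Notation V := 'I_n.+1.
Implicit Types G H S T : {set V * V}.

Lemma graph_lt G i j : is_graph G -> (i, j) \in G -> (i < j)%N.
Proof. by move=> /forallP/(_ i)/forallP/(_ j)/implyP. Qed.

Lemma noncrossingP G : reflect (forall i j k l : V, (i < j)%N -> (j < k)%N ->
  (k < l)%N -> (i, k) \in G -> (j, l) \notin G) (noncrossing G).
Proof.
apply: (iffP forallP) => [ncG i j k l ij jk kl ikG|ncG i].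
  have /forallP/(_ j)/forallP/(_ k)/forallP/(_ l) := ncG i.
  by rewrite ij jk kl ikG.
apply/forallP => j; apply/forallP => k; apply/forallP => l.
by apply/and5P => -[ij jk kl ikG]; apply/negP/(ncG i j k l).
Qed.

Lemma alternatingP G : reflect (forall i j k : V, (i < j)%N -> (j < k)%N ->
  (i, j) \in G -> (j, k) \notin G) (Defs.alternating G).
Proof.
apply: (iffP forallP) => [aG i j k ij jk ijG|aG i].
  have /forallP/(_ j)/forallP/(_ k) := aG i.
  by rewrite ij jk ijG.
apply/forallP => j; apply/forallP => k.
by apply/and4P => -[ij jk ijG]; apply/negP/(aG i j k).
Qed.

End graph_predicates.

Section combinations.
Variables (R : realType) (n : nat).
Local Notation V := 'I_n.+1.
Implicit Types G H S T : {set V * V}.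

Lemma root_coord (i j v : V) : Defs.root R i j 0 v = (i == v)%:R - (j == v)%:R.
Proof. by rewrite /Defs.root !mxE/= [v == i]eq_sym [v == j]eq_sym. Qed.

Lemma root_trans (i j k : V) : Defs.root R i j + Defs.root R j k = Defs.root R i k.
Proof. by rewrite /Defs.root addrA subrK. Qed.

Lemma root_opp (i j : V) : - Defs.root R i j = Defs.root R j i.
Proof. by rewrite /Defs.root opprB. Qed.

Lemma root_refl (i : V) : Defs.root R i i = 0.
Proof. by rewrite /Defs.root subrr. Qed.

(** The sum runs over all pairs, so that expansions on different graphs can be compared as
    functions; supports are imposed separately. *)
Definition comb (c : V * V -> R) : 'rV[R]_n.+1 := \sum_e c e *: Defs.root R e.1 e.2.

(** With [c] viewed as a flow on the edges, the coordinate at [v] is its net outflow there. *)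
Lemma combE c v : comb c 0 v = \sum_w c (v, w) - \sum_u c (u, v).
Proof.
rewrite /comb summxE.
rewrite (eq_bigr (fun e => (c (e.1, e.2) *: Defs.root R e.1 e.2) 0 v)); last by case.
rewrite -(pair_bigA _ (fun i j => (c (i, j) *: Defs.root R i j) 0 v))/=.
under eq_bigr => i _ do under eq_bigr => j _ do rewrite mxE root_coord mulrBr.
under eq_bigr do rewrite sumrB; rewrite sumrB; congr (_ - _).
  rewrite (bigD1 v)//= [X in _ + X]big1 ?addr0.
    by apply: eq_bigr => j _; rewrite eqxx mulr1.
  by move=> i /negPf iv; rewrite big1// => j _; rewrite iv mulr0.
apply: eq_bigr => i _; rewrite (bigD1 v)//= eqxx mulr1 big1 ?addr0//.
by move=> j /negPf jv; rewrite jv mulr0.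
Qed.

Lemma comb_supp (c : V * V -> R) S : (forall e, e \notin S -> c e = 0) ->
  comb c = \sum_(e in S) c e *: Defs.root R e.1 e.2.
Proof.
move=> cS; rewrite /comb (bigID (mem S))/= [X in _ + X]big1 ?addr0// => e eS.
by rewrite cS ?scale0r.
Qed.

(* A shortest edge (i, j) with d < c would force, by conservation at i and at
   j, d-edges (i, w) with w > j and (u, j) with u < i, which cross. *)
Lemma na_comb_le S1 S2 (c d : V * V -> R) (i j : V) :
  is_graph S1 -> is_graph S2 -> Defs.alternating S1 ->
  Defs.alternating S2 -> noncrossing S2 ->
  (forall e, 0 <= c e) -> (forall e, 0 <= d e) ->
  (forall e, e \notin S1 -> c e = 0) -> (forall e, e \notin S2 -> d e = 0) ->
  comb c = comb d ->
  (forall k l : V, (l - k < j - i)%N -> c (k, l) = d (k, l)) ->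
  c (i, j) <= d (i, j).
Proof.
move=> g1 g2 /alternatingP a1 /alternatingP a2 /noncrossingP nc2 c0 d0 c1 d2 cd IH.
rewrite leNgt; apply/negP => dc.
have in1 e : 0 < c e -> e \in S1 by apply: contraPT => /c1 ->; rewrite ltxx.
have in2 e : 0 < d e -> e \in S2 by apply: contraPT => /d2 ->; rewrite ltxx.
have pc : 0 < c (i, j) by exact: le_lt_trans dc.
have ijS := in1 _ pc; have ij := graph_lt g1 ijS.
have cV v : \sum_w c (v, w) - \sum_u c (u, v) = \sum_w d (v, w) - \sum_u d (u, v).
  by rewrite -!combE cd.
(* Since (i, j) is an edge of the alternating graph [S1], nothing enters [i] and nothing leaves
   [j]. *)
have ci0 u : c (u, i) = 0.
  apply: c1; apply/negP => uiS; move: ijS; apply/negP/(a1 u) => //.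
  exact: graph_lt uiS.
have cj0 w : c (j, w) = 0.
  apply: c1; apply/negP => jwS; move: (jwS); apply/negP/(a1 i) => //.
  exact: graph_lt jwS.
(* The net outflow at [i] is positive, so some [d]-edge leaves [i], and alternation of [S2] then
   excludes [d]-flow into [i]; [j] is treated dually. *)
have [w1 dw1] : exists w, 0 < d (i, w).
  apply: contrapT => /forallNP nd; have := cV i.
  rewrite [X in _ - X = _]big1// subr0 [X in _ = X - _]big1; last first.
    by move=> w _; apply/eqP; rewrite eq_le d0 andbT leNgt; apply/negP/nd.
  move=> E; have : 0 < \sum_w c (i, w).
    by rewrite (bigD1 j)//= ltr_wpDr// sumr_ge0.
  by rewrite E sub0r oppr_gt0 ltNge sumr_ge0.
have [u1 du1] : exists u, 0 < d (u, j).
  apply: contrapT => /forallNP nd; have := cV j.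
  rewrite [X in X - _ = _]big1// sub0r [X in _ = _ - X]big1; last first.
    by move=> w _; apply/eqP; rewrite eq_le d0 andbT leNgt; apply/negP/nd.
  move=> E; have : 0 < \sum_u c (u, j).
    by rewrite (bigD1 i)//= ltr_wpDr// sumr_ge0.
  by rewrite -oppr_lt0 E subr0 ltNge sumr_ge0.
have di0 u : d (u, i) = 0.
  apply: d2; apply/negP => uiS; move: (in2 _ dw1); apply/negP/(a2 u) => //.
    exact: graph_lt uiS.
  exact: graph_lt (in2 _ dw1).
have dj0 w : d (j, w) = 0.
  apply: d2; apply/negP => jwS; move: (jwS); apply/negP/(a2 u1) => //.
  - exact: graph_lt (in2 _ du1).
  - exact: graph_lt jwS.
  - exact: in2.
have [w cdw] : exists w, c (i, w) < d (i, w).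
  apply: (@sum_eq_exists_lt _ _ (fun w => c (i, w)) (fun w => d (i, w)) j) => //.
  by have := cV i; rewrite [X in _ - X = _]big1// [X in _ = _ - X]big1// !subr0.
have [u cdu] : exists u, c (u, j) < d (u, j).
  apply: (@sum_eq_exists_lt _ _ (fun u => c (u, j)) (fun u => d (u, j)) i) => //.
  have := cV j; rewrite [X in X - _ = _]big1// [X in _ = X - _]big1// !sub0r.
  exact: oppr_inj.
have iwS : (i, w) \in S2 by apply: in2; exact: le_lt_trans cdw.
have ujS : (u, j) \in S2 by apply: in2; exact: le_lt_trans cdu.
have iw := graph_lt g2 iwS; have uj := graph_lt g2 ujS.
(* If [w] came before [j], the pair (i, w) would be shorter than (i, j), where [c] and [d] agree;
   [w] equal to [j] contradicts [dc]. *)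
have jw : (j < w)%N.
  have [wj|//|wj] := ltngtP w j.
    by move: cdw; rewrite IH ?ltxx// ltn_sub2r.
  by move: cdw; rewrite (val_inj wj) ltNge (ltW dc).
have ui : (u < i)%N.
  have [//|iu|ui] := ltngtP u i.
    by move: cdu; rewrite IH ?ltxx// ltn_sub2l.
  by move: cdu; rewrite (val_inj ui) ltNge (ltW dc).
by move: iwS; apply/negP/(nc2 u i j w).
Qed.

(** Strong induction on the length [j - i], with [na_comb_le] applied twice, the two expansions
    being exchanged. *)
Theorem na_comb_inj S1 S2 (c d : V * V -> R) :
  is_graph S1 -> is_graph S2 -> Defs.alternating S1 -> noncrossing S1 ->
  Defs.alternating S2 -> noncrossing S2 ->
  (forall e, 0 <= c e) -> (forall e, 0 <= d e) ->
  (forall e, e \notin S1 -> c e = 0) -> (forall e, e \notin S2 -> d e = 0) ->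
  comb c = comb d -> c =1 d.
Proof.
move=> g1 g2 a1 nc1 a2 nc2 c0 d0 c1 d2 cd [i j].
have [m] := ubnP (j - i)%N; elim: m i j => // m IHm i j; rewrite ltnS => jim.
apply/eqP; rewrite eq_le; apply/andP; split.
  by apply: (na_comb_le g1 g2) => // k l kl; apply: IHm; exact: leq_trans jim.
apply: (na_comb_le g2 g1) => // k l kl; apply/esym/IHm; exact: leq_trans jim.
Qed.

(** The positive and negative parts of [a] are two nonnegative expansions of the same vector
    supported in [S], so they coincide. *)
Corollary na_comb_free S (a : V * V -> R) :
  is_graph S -> Defs.alternating S -> noncrossing S ->
  (forall e, e \notin S -> a e = 0) -> comb a = 0 -> forall e, a e = 0.
Proof.
move=> gS aS nS a0 ca e.
have : (fun e => Num.max (a e) 0) =1 (fun e => Num.max (- a e) 0).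
  apply: (@na_comb_inj S S) => //.
  - by move=> f; rewrite le_max lexx orbT.
  - by move=> f; rewrite le_max lexx orbT.
  - by move=> f /a0 ->; rewrite maxxx.
  - by move=> f /a0 ->; rewrite oppr0 maxxx.
  apply/eqP; rewrite -subr_eq0 -[X in _ == X]ca /comb -sumrB.
  apply/eqP/eq_bigr => f _; rewrite -scalerBl; congr (_ *: _).
  by case: (leP (a f) 0); case: (leP (- a f) 0); lra.
by move=> /(_ e)/=; case: (leP (a e) 0); case: (leP (- a e) 0); lra.
Qed.

End combinations.

(** * Covering a root cone *)

Section reductions.
Variable n : nat.
Local Notation V := 'I_n.+1.
Implicit Types G H S T : {set V * V}.

Lemma adj_sym G : symmetric (adj G).
Proof. by move=> i j; rewrite /adj orbC. Qed.

Lemma connected_sub G H : connected_graph G ->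
  (forall i j, (i, j) \in G -> connect (adj H) i j) -> connected_graph H.
Proof.
move=> /forallP cG GH; apply/forallP => i; apply/forallP => j.
have /forallP/(_ j) := cG i; apply: connect_sub => {i j} i j /orP[]; first exact: GH.
by rewrite (sym_connect_sym (@adj_sym H)); exact: GH.
Qed.

(* The outermost edges meeting at a middle vertex j can be composed without
   creating a crossing. *)
Lemma noncrossing_compose G (i j k : V) : is_graph G -> noncrossing G ->
  (i, j) \in G -> (j, k) \in G ->
  (forall u, (u, j) \in G -> (i <= u)%N) -> (forall w, (j, w) \in G -> (w <= k)%N) ->
  noncrossing ((i, k) |: G).
Proof.
move=> gG /noncrossingP ncG ijG jkG imin kmax.
have ij := graph_lt gG ijG; have jk := graph_lt gG jkG.
apply/noncrossingP => a b c d ab bc cd; rewrite !inE => /orP[/eqP[ai ck]|acG].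
  subst a c; apply/negP => /orP[/eqP[bi _]|bdG].
    by move: ab; rewrite bi ltnn.
  (* An edge (b, d) crossing (i, k) already crosses (i, j) or (j, k), unless [b] is [j]; then [d]
     beyond [k] contradicts the maximality of [k]. *)
  have [bj|jb|bj] := ltngtP b j.
  - move: bdG; apply/negP/(ncG i b j d) => //.
    exact: ltn_trans cd.
  - by move: bdG; apply/negP/(ncG j b k d).
  - by move: cd; rewrite ltnNge kmax// -(val_inj bj).
apply/negP => /orP[/eqP[bi dk]|bdG].
  subst b d; have [cj|jc|cj] := ltngtP c j.
  - by move: ijG; apply/negP/(ncG a i c j).
  - move: jkG; apply/negP/(ncG a j c k) => //.
    exact: ltn_trans ij.
  - by move: ab; rewrite ltnNge imin// -(val_inj cj).
by move: bdG; apply/negP/(ncG a b c d).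
Qed.

Lemma graph_composeD G (i j k : V) (f : V * V) : is_graph G ->
  (i, j) \in G -> (j, k) \in G -> is_graph ((i, k) |: G :\ f).
Proof.
move=> gG ijG jkG; apply/forallP => u; apply/forallP => v; apply/implyP.
rewrite !inE => /orP[/eqP[-> ->]|/andP[_ uvG]]; last exact: graph_lt uvG.
exact: ltn_trans (graph_lt gG ijG) (graph_lt gG jkG).
Qed.

Lemma noncrossingS G H : G \subset H -> noncrossing H -> noncrossing G.
Proof.
move=> /fintype.subsetP GH /noncrossingP ncH; apply/noncrossingP => i j k l ij jk kl ikG.
by apply/negP => /GH; apply/negP/(ncH i j k l) => //; exact: GH.
Qed.

(** Termination measure of the rewriting: edges have positive weight, and longer edges weigh
    less. *)
Definition colength G : nat := (\sum_(e in G) (n.+1 - (e.2 - e.1)))%N.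

Lemma colength_replace G (e f : V * V) : f \in G -> (f.2 - f.1 < e.2 - e.1)%N ->
  (colength (e |: G :\ f) < colength G)%N.
Proof.
move=> fG fe; rewrite /colength [ltnRHS](big_setD1 f fG)/=.
apply: (@leq_ltn_trans (n.+1 - (e.2 - e.1) +
    \sum_(g in G :\ f) (n.+1 - (g.2 - g.1)))%N); last first.
  rewrite ltn_add2r ltn_sub2l// (leq_ltn_trans (leq_subr _ _))//.
(* If [e] is already present, the sum just loses the term of [f]. *)
have [eG|eG] := boolP (e \in G :\ f).
  by rewrite (finset.setUidPr _) ?finset.sub1set// leq_addl.
by rewrite big_setU1.
Qed.

End reductions.

Section cone_cover.
Variables (R : realType) (n : nat).
Local Notation V := 'I_n.+1.
Implicit Types G H S T : {set V * V}.

Lemma root_coneP G (x : 'rV[R]_n.+1) : root_cone G x <->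
  exists c : V * V -> R, [/\ forall e, 0 <= c e, forall e, e \notin G -> c e = 0
    & x = comb c].
Proof.
split=> [[c [c0 ->]]|[c [c0 cG ->]]]; last by exists c; split => //; exact: comb_supp.
exists (fun e => if e \in G then c e else 0); split=> [e|e /negPf->//|].
  by case: ifP.
rewrite (@comb_supp _ _ _ G) => [|e /negPf->//].
by apply: eq_bigr => e ->.
Qed.

Lemma combD (c d : V * V -> R) : comb (fun e => c e + d e) = comb c + comb d.
Proof. by rewrite /comb -big_split; apply: eq_bigr => e _; rewrite scalerDl. Qed.

Lemma combZ (a : R) (c : V * V -> R) : comb (fun e => a * c e) = a *: comb c.
Proof. by rewrite /comb scaler_sumr; apply: eq_bigr => e _; rewrite scalerA. Qed.

Lemma comb_delta (f : V * V) : comb (fun e => (e == f)%:R) = Defs.root R f.1 f.2.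
Proof.
rewrite /comb (bigD1 f)//= eqxx scale1r big1 ?addr0// => e /negPf ->.
by rewrite scale0r.
Qed.

(* a (i, j) + b (j, k) = m (i, k) + (a - m) (i, j) + (b - m) (j, k), where
   m = min(a, b), so one of the last two terms vanishes. *)
Lemma root_cone_split G (i j k : V) (x : 'rV[R]_n.+1) : is_graph G ->
  (i, j) \in G -> (j, k) \in G -> root_cone G x ->
  root_cone ((i, k) |: G :\ (i, j)) x \/ root_cone ((i, k) |: G :\ (j, k)) x.
Proof.
move=> gG ijG jkG /root_coneP[c [c0 cG ->]].
have ij := graph_lt gG ijG; have jk := graph_lt gG jkG.
pose m := Num.min (c (i, j)) (c (j, k)).
pose d e : R := c e + m * ((e == (i, k))%:R + - 1 * ((e == (i, j))%:R + (e == (j, k))%:R)).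
have cd : comb c = comb d.
  rewrite /d combD combZ combD combZ combD !comb_delta/= root_trans scaleN1r subrr.
  by rewrite scaler0 addr0.
have ij_jk : (i, j) == (j, k) = false.
  by apply/eqP => -[ji _]; move: ij; rewrite ji ltnn.
have ij_ik : (i, j) == (i, k) = false.
  by apply/eqP => -[ji]; move: jk; rewrite ji ltnn.
have jk_ik : (j, k) == (i, k) = false.
  by apply/eqP => -[ji]; move: ij; rewrite ji ltnn.
have dij : d (i, j) = c (i, j) - m by rewrite /d ij_ik ij_jk eqxx /=; ring.
have djk : d (j, k) = c (j, k) - m.
  by rewrite /d jk_ik [_ == (i, j)]eq_sym ij_jk eqxx /=; ring.
have m0 : 0 <= m by rewrite le_min !c0.
have d0 e : 0 <= d e.
  have [->|eij] := eqVneq e (i, j); first by rewrite dij subr_ge0 ge_min lexx.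
  have [->|ejk] := eqVneq e (j, k); first by rewrite djk subr_ge0 ge_min lexx orbT.
  rewrite /d (negPf eij) (negPf ejk) /= addr0 mulr0 addr0.
  by rewrite addr_ge0// mulr_ge0.
have dG e : e != (i, k) -> e \notin G -> d e = 0.
  move=> /negPf eik eG; rewrite /d cG// eik.
  have /negPf -> : e != (i, j) by apply: contraNneq eG => ->.
  have /negPf -> : e != (j, k) by apply: contraNneq eG => ->.
  by rewrite /= !(addr0, mulr0).
have [cc|cc] := leP (c (i, j)) (c (j, k)); [left|right]; apply/root_coneP; exists d;
  split => // e; rewrite !inE negb_or negb_and negbK => /andP[eik /orP[/eqP->|]];
  do ?exact: dG.
- by rewrite dij /m min_l// subrr.
- by rewrite djk /m min_r ?subrr// ltW.
Qed.

(** Induction on [colength], with [H] fixed and transitive so that compositions stay inside it.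
    Which edge is dropped depends on [x]; connectivity survives because the dropped edge forms a
    triangle with the two kept ones. *)
Lemma na_cover G H (x : 'rV[R]_n.+1) : is_graph G -> connected_graph G ->
  noncrossing G -> G \subset H ->
  (forall i j k, (i, j) \in H -> (j, k) \in H -> (i, k) \in H) ->
  root_cone G x ->
  exists S, [/\ is_graph S, connected_graph S, noncrossing S & Defs.alternating S]
    /\ S \subset H /\ root_cone S x.
Proof.
move=> + + + + trH; have [m] := ubnP (colength G); elim: m G => // m IHm G.
rewrite ltnS => Gm gG cG ncG GH Gx.
have [aG|] := boolP (Defs.alternating G); first by exists G.
rewrite negb_forall => /existsP[i0]; rewrite negb_forall => /existsP[j].
rewrite negb_forall => /existsP[k0]; rewrite negbK => /and4P[_ _ ijG jkG].
(* The failure of alternation at [j] is moved to the outermost edges, as [noncrossing_compose]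
   requires. *)
have [i {}ijG imin] := @arg_minnP _ i0 (fun u => (u, j) \in G) val ijG.
have [k {}jkG kmax] := @arg_maxnP _ k0 (fun w => (j, w) \in G) val jkG.
clear i0 k0.
have ij := graph_lt gG ijG; have jk := graph_lt gG jkG.
have ncG' := noncrossing_compose gG ncG ijG jkG imin kmax.
have red f : f \in G -> (f.2 - f.1 < k - i)%N ->
    (forall u v, (u, v) \in G -> connect (adj ((i, k) |: G :\ f)) u v) ->
    root_cone ((i, k) |: G :\ f) x ->
    exists S, [/\ is_graph S, connected_graph S, noncrossing S & Defs.alternating S]
      /\ S \subset H /\ root_cone S x.
  move=> fG fl fc; apply: IHm.
  - exact: leq_trans (colength_replace fG _) Gm.
  - exact: graph_composeD ijG jkG.
  - exact: connected_sub fc.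
  - by apply: noncrossingS ncG'; rewrite finset.setUS// finset.subD1set.
  - rewrite finset.subUset finset.sub1set (trH i j k) ?(fintype.subsetP GH)//=.
    exact: fintype.subset_trans (finset.subD1set _ _) GH.
have adj1 (e f : V * V) : e \in G -> e != f -> adj ((i, k) |: G :\ f) e.1 e.2.
  by case: e => u v eG ef; rewrite /adj /edge !inE ef eG orbT.
have adjik f : adj ((i, k) |: G :\ f) i k.
  by rewrite /adj /edge !inE eqxx.
have ij_jk : (i, j) != (j, k).
  by apply/eqP => -[ji _]; move: ij; rewrite ji ltnn.
have [xG|xG] := root_cone_split gG ijG jkG Gx; apply: red xG => //.
- by rewrite /= ltn_sub2r// (ltn_trans ij).
- move=> u v uvG; have [[-> ->]|ne] := eqVneq (u, v) (i, j).
    apply: (@connect_trans _ _ k); first exact: connect1.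
    apply: connect1; rewrite adj_sym; apply: (adj1 (j, k)) => //.
    by rewrite eq_sym.
  by apply: connect1; exact: (adj1 (u, v)).
- by rewrite /= ltn_sub2l// (ltn_trans ij).
- move=> u v uvG; have [[-> ->]|ne] := eqVneq (u, v) (j, k).
    apply: (@connect_trans _ _ i); last exact: connect1.
    by apply: connect1; rewrite adj_sym; exact: (adj1 (i, j)).
  by apply: connect1; exact: (adj1 (u, v)).
Qed.

End cone_cover.

(** * Transitive closure and root cones *)

Section tclosure_theory.
Variables (R : realType) (n : nat).
Local Notation V := 'I_n.+1.
Implicit Types G H S T : {set V * V}.

Lemma tclosureP T i j : reflect (exists s : seq V, path (edge T) i (rcons s j))
  ((i, j) \in tclosure T).
Proof. by rewrite inE; exact: asboolP. Qed.

Lemma sub_tclosure T : T \subset tclosure T.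
Proof.
apply/fintype.subsetP => -[i j] ijT; apply/tclosureP; exists [::].
by rewrite /= /edge ijT.
Qed.

Lemma tclosure_trans T i j k :
  (i, j) \in tclosure T -> (j, k) \in tclosure T -> (i, k) \in tclosure T.
Proof.
move=> /tclosureP[s ps] /tclosureP[t pt]; apply/tclosureP.
by exists (rcons s j ++ t); rewrite rcons_cat cat_path ps last_rcons.
Qed.

Lemma root_cone0 G : root_cone G (0 : 'rV[R]_n.+1).
Proof.
by exists (fun=> 0); split => //; rewrite big1// => e _; rewrite scale0r.
Qed.

Lemma root_coneD G (x y : 'rV[R]_n.+1) :
  root_cone G x -> root_cone G y -> root_cone G (x + y).
Proof.
move=> [c [c0 ->]] [d [d0 ->]]; exists (fun e => c e + d e); split.
  by move=> e; rewrite addr_ge0.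
by rewrite -big_split; apply: eq_bigr => e _; rewrite scalerDl.
Qed.

Lemma root_coneZ G (a : R) (x : 'rV[R]_n.+1) :
  0 <= a -> root_cone G x -> root_cone G (a *: x).
Proof.
move=> a0 [c [c0 ->]]; exists (fun e => a * c e); split.
  by move=> e; rewrite mulr_ge0.
by rewrite scaler_sumr; apply: eq_bigr => e _; rewrite scalerA.
Qed.

Lemma root_cone_root G i j : (i, j) \in G -> root_cone G (Defs.root R i j).
Proof.
move=> ijG; apply/root_coneP; exists (fun e => (e == (i, j))%:R); split => //.
- by move=> e eG; case: eqP eG => // -> /negP.
- by rewrite comb_delta.
Qed.

Lemma root_cone_sub G H : (forall i j, (i, j) \in G -> root_cone H (Defs.root R i j)) ->
  root_cone G `<=` (root_cone H : set 'rV[R]_n.+1).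
Proof.
move=> GH _ [c [c0 ->]]; apply: big_ind.
- exact: root_cone0.
- by move=> x y; exact: root_coneD.
- by move=> [i j] ijG; apply: root_coneZ => //; exact: GH.
Qed.

(** Roots telescope along a path, so the root of an edge of the closure is a sum of roots of [T]. *)
Lemma root_cone_tclosure T :
  root_cone (tclosure T) `<=` (root_cone T : set 'rV[R]_n.+1).
Proof.
apply: root_cone_sub => i j /tclosureP[s].
elim: s i => [|k s IHs] i /=; first by rewrite andbT; exact: root_cone_root.
move=> /andP[ik /IHs kj]; rewrite -(root_trans R i k j).
by apply: root_coneD kj; exact: root_cone_root.
Qed.

End tclosure_theory.

(** * Acyclicity and unimodularity *)

Section bases.
Variables (R : realType) (n : nat).
Local Notation V := 'I_n.+1.
Implicit Types G H S T : {set V * V}.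

(** Telescoping along a walk, an edge traversed backwards counting -1. Integrality of the
    coefficients later yields unimodularity. *)
Lemma connect_root G u v : connect (adj G) u v -> exists a : V * V -> int,
  (forall e, e \notin G -> a e = 0) /\
  Defs.root R u v = comb (fun e => (a e)%:~R).
Proof.
move=> /connectP[s + ->]; elim: s u => [|w s IHs] u /=.
  move=> _; exists (fun=> 0); split => //.
  by rewrite root_refl /comb big1// => e _; rewrite scale0r.
move=> /andP[uw /IHs[a [aG wE]]].
have [f [z [fG uwE]]] : exists f (z : int), f \in G /\
    Defs.root R u w = z%:~R *: Defs.root R f.1 f.2.
  case/orP: uw => uwG; first by exists (u, w), 1; rewrite scale1r.
  by exists (w, u), (-1); rewrite mulrN1z scaleN1r root_opp.
exists (fun e => a e + z * (e == f)%:R); split => [e eG|].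
  rewrite aG// add0r; case: eqP => [ef|_]; last by rewrite mulr0.
  by rewrite ef fG in eG.
rewrite -(root_trans R u w) wE uwE -comb_delta -combZ addrC -combD.
by apply: eq_bigr => e _; rewrite intrD intrM; case: (e == f).
Qed.

(** A walk that avoids an endpoint of [e] cannot traverse [e]. *)
Lemma path_adjD1 G (e : V * V) v x s : (e.1 == v) || (e.2 == v) ->
  path (adj G) x s -> v \notin x :: s -> path (adj (G :\ e)) x s.
Proof.
move=> ev; elim: s x => //= y s IHs x /andP[xy ys].
rewrite !inE !negb_or => /and3P[vx vy vs].
rewrite IHs// ?inE ?negb_or ?vy// andbT.
have ne : (e != (x, y)) && (e != (y, x)).
  apply/andP; split; apply/eqP => E; move: ev; rewrite E/=;
  by rewrite ![_ == v]eq_sym (negPf vx) (negPf vy).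
move: ne => /andP[exy eyx]; move: xy.
by rewrite /adj /edge !inE ![_ == e]eq_sym exy eyx.
Qed.

(* An edge of a cycle is redundant for connectivity, so its root is a
   combination of the roots of the other edges. *)
Lemma na_acyclic S : is_graph S -> noncrossing S -> Defs.alternating S -> acyclic S.
Proof.
move=> gS ncS aS; apply/asboolP => -[|u [|v [|w p]]]//= _.
rewrite /ucycle/= => /andP[/and3P[uv vw wp]].
rewrite !inE !negb_or => /and4P[/and3P[u_v u_w u_p] /andP[v_w v_p] _ _].
have [e [eS [euv ev]]] : exists e : V * V, e \in S /\
    (e = (u, v) \/ e = (v, u)) /\ (e.1 == v) || (e.2 == v).
  case/orP: uv => uvS; [exists (u, v)|exists (v, u)]; rewrite /= eqxx ?orbT.
    by split=> //; split=> //; left.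
  by split=> //; split=> //; right.
have cvu : connect (adj (S :\ e)) v u.
  apply: (@connect_trans _ _ w).
    apply: connect1; move: vw; rewrite /adj /edge !inE.
    have -> : (v, w) != e.
      apply/eqP => E; case: euv => E'; move: E; rewrite E' => -[].
        by move=> vu; rewrite vu eqxx in u_v.
      by move=> wu; rewrite wu eqxx in u_w.
    have -> : (w, v) != e.
      apply/eqP => E; case: euv => E'; move: E; rewrite E' => -[].
        by move=> wu; rewrite wu eqxx in u_w.
      by move=> wv; rewrite wv eqxx in v_w.
    by [].
  apply/connectP; exists (rcons p u); last by rewrite last_rcons.
  apply: (path_adjD1 ev wp); rewrite inE mem_rcons inE !negb_or v_w v_p andbT.
  by rewrite eq_sym u_v.
have [a [aS' vuE]] := connect_root cvu.
(* [s] is the orientation of [e] along the cycle: the root from [v] to [u] plus [s] times the root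
   of [e] is 0, so independence would force [s] to vanish. *)
pose s : R := if e == (u, v) then 1 else -1.
have s0 : s <> 0 by rewrite /s; case: ifP => _; lra.
apply: s0; have := @na_comb_free R n S (fun f => (a f)%:~R + s * (f == e)%:R) gS aS ncS.
move=> /(_ _ _ e); rewrite aS' ?inE ?eqxx// add0r mulr1; apply.
  move=> f fS; have fe : f != e by apply: contraNneq fS => ->.
  by rewrite aS' ?inE ?fe// (negPf fe) mulr0 addr0.
rewrite combD combZ comb_delta -vuE /s.
have [->|euv'] := eqVneq e (u, v).
  by rewrite scale1r/= root_trans root_refl.
case: euv => [E|->]; first by rewrite E eqxx in euv'.
by rewrite scaleN1r/= subrr.
Qed.

(** The reduced incidence matrix, in the coordinates of [chart]. The number [k] of edges stays free
    until it is shown to be [n]. *)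
Definition basis_mx k (e : 'I_k -> V * V) : 'M[R]_(k, n) :=
  \matrix_(i, j) Defs.root R (e i).1 (e i).2 0 (lift ord_max j).

Lemma comb_enum k (e : 'I_k -> V * V) (c : V * V -> R) : injective e ->
  (forall f, f \notin [set e i | i : 'I_k]%SET -> c f = 0) ->
  comb c = \sum_i c (e i) *: Defs.root R (e i).1 (e i).2.
Proof.
move=> einj /comb_supp ->; rewrite big_imset//= => i j _ _; exact: einj.
Qed.

Lemma enum_coef k (e : 'I_k -> V * V) (u : 'I_k -> R) : injective e ->
  exists c : V * V -> R, [/\ forall f, f \notin [set e i | i : 'I_k]%SET -> c f = 0,
    forall i, c (e i) = u i &
    comb c = \sum_i u i *: Defs.root R (e i).1 (e i).2].
Proof.
move=> einj; pose c f := \sum_i u i * (f == e i)%:R.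
have ce i : c (e i) = u i.
  rewrite /c (bigD1 i)//= eqxx mulr1 big1 ?addr0// => j ji.
  by rewrite (inj_eq einj) eq_sym (negPf ji) mulr0.
have cS f : f \notin [set e i | i : 'I_k]%SET -> c f = 0.
  move=> fS; rewrite /c big1// => i _; case: eqP => [fe|_]; last by rewrite mulr0.
  by move: fS; rewrite fe imset_f.
exists c; split => //; rewrite (comb_enum einj cS).
by apply: eq_bigr => i _; rewrite ce.
Qed.

Lemma comb_sum0 (c : V * V -> R) : \sum_i comb c 0 i = 0.
Proof.
under eq_bigr do rewrite combE.
by rewrite sumrB [X in X - _]exchange_big/= subrr.
Qed.

Lemma hyperplane_eq (x y : 'rV[R]_n.+1) : \sum_i x 0 i = 0 -> \sum_i y 0 i = 0 ->
  (forall j, x 0 (lift ord_max j) = y 0 (lift ord_max j)) -> x = y.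
Proof.
move=> /chart_hyperplane[s _ <-] /chart_hyperplane[t _ <-] st.
by congr chart; apply: eq_from_tnth => i; rewrite -!chart_coord.
Qed.

Lemma basis_mx_mull k (e : 'I_k -> V * V) (c : V * V -> R) (j : 'I_n) :
  injective e -> (forall f, f \notin [set e i | i : 'I_k]%SET -> c f = 0) ->
  comb c 0 (lift ord_max j) = \sum_i c (e i) * basis_mx e i j.
Proof.
move=> einj ce; rewrite (comb_enum einj ce) summxE.
by apply: eq_bigr => i _; rewrite !mxE.
Qed.

(** By connectivity each basis vector of the lattice is an integral combination of the roots; the
    coefficients form [N]. *)
Lemma basis_mx_linv k (e : 'I_k -> V * V) : injective e ->
  connected_graph [set e i | i : 'I_k]%SET ->
  exists N : 'M[int]_(n, k), map_mx intr N *m basis_mx e = 1%:M.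
Proof.
move=> einj /forallP cS.
have /choice[a aP] (j : 'I_n) : exists a : V * V -> int,
    (forall f, f \notin [set e i | i : 'I_k]%SET -> a f = 0) /\
    Defs.root R (lift ord_max j) ord_max = comb (fun f => (a f)%:~R).
  by apply: connect_root; have /forallP := cS (lift ord_max j).
exists (\matrix_(j, i) a j (e i)); apply/matrixP => j l; rewrite !mxE.
have [aS aE] := aP j.
rewrite [RHS](_ : _ = Defs.root R (lift ord_max j) ord_max 0 (lift ord_max l)).
  rewrite aE (basis_mx_mull _ einj) => [|f /aS ->//].
  by apply: eq_bigr => i _; rewrite !mxE.
rewrite root_coord (inj_eq lift_inj) [ord_max == _](negPf (neq_lift _ _)).
by rewrite subr0.
Qed.

(** The dropped last coordinate is determined by the others, as coordinates sum to 0, so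
    [na_comb_free] applies. *)
Lemma basis_mx_free k (e : 'I_k -> V * V) (u : 'rV[R]_k) : injective e ->
  let S := [set e i | i : 'I_k]%SET in
  is_graph S -> noncrossing S -> Defs.alternating S ->
  u *m basis_mx e = 0 -> u = 0.
Proof.
move=> einj S gS ncS aS ue.
have [c [cS ce _]] := enum_coef (u 0) einj.
apply/rowP => i; rewrite -ce mxE; apply: (na_comb_free gS aS ncS) => //.
apply: hyperplane_eq; first exact: comb_sum0.
  by rewrite big1// => j _; rewrite mxE.
move=> j; rewrite (basis_mx_mull j einj cS).
under eq_bigr do rewrite ce.
by move/matrixP/(_ 0 j) : ue; rewrite mxE [in X in _ = X -> _]mxE => ->; rewrite mxE.
Qed.

(** Each row of [basis_mx e *m N - 1%:M] is annihilated by [basis_mx e], whose rows are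
    independent. *)
Lemma basis_mx_rinv k (e : 'I_k -> V * V) (N : 'M[R]_(n, k)) : injective e ->
  let S := [set e i | i : 'I_k]%SET in
  is_graph S -> noncrossing S -> Defs.alternating S ->
  N *m basis_mx e = 1%:M -> basis_mx e *m N = 1%:M.
Proof.
move=> einj S gS ncS aS NM; apply/eqP; rewrite -subr_eq0; apply/eqP/row_matrixP => i.
rewrite row0; apply: (basis_mx_free einj) => //.
by rewrite -row_mul mulmxBl -mulmxA NM mulmx1 mul1mx subrr row0.
Qed.

(* The incidence matrix has an integral left inverse by connectivity, and
   independent rows, so it is square and unimodular. *)
Lemma na_basis S : is_graph S -> connected_graph S -> noncrossing S ->
  Defs.alternating S -> exists e : 'I_n -> V * V,
  [/\ injective e, S = [set e i | i : 'I_n]%SET & `|\det (basis_mx e)| = 1].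
Proof.
move=> gS cS ncS aS.
have SE : S = [set enum_val i | i : 'I_#|S|]%SET.
  apply/setP => f; apply/idP/imsetP => [fS|[i _ ->]]; last exact: enum_valP.
  by exists (enum_rank_in fS f) => //; rewrite enum_rankK_in.
have Sn : #|S| = n.
  have ei := @enum_val_inj _ (mem S).
  rewrite SE in gS cS ncS aS.
  have [N NM] := basis_mx_linv ei cS.
  have MN := basis_mx_rinv ei gS ncS aS NM.
  (* Inverses on both sides bound the number of edges by [n] from above and from below. *)
  by apply/eqP; rewrite eqn_leq (mulmx1_min MN) (mulmx1_min NM).
pose e i := enum_val (cast_ord (esym Sn) i).
have ei : injective e by move=> i j /enum_val_inj/cast_ord_inj.
have SeE : S = [set e i | i : 'I_n]%SET.
  rewrite [LHS]SE; apply/setP => f; apply/imsetP/imsetP => -[i _ ->].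
    by exists (cast_ord Sn i) => //; rewrite /e cast_ordK.
  by exists (cast_ord (esym Sn) i).
exists e; split=> //; rewrite SeE in cS.
have [N NM] := basis_mx_linv ei cS.
pose M : 'M[int]_n :=
  \matrix_(i, j) (((e i).1 == lift ord_max j)%:R - ((e i).2 == lift ord_max j)%:R).
have eM : basis_mx e = map_mx intr M.
  by apply/matrixP => i j; rewrite [LHS]mxE root_coord !mxE rmorphB/= !rmorph_nat.
move: NM; rewrite eM => /(congr1 determinant).
rewrite det_mulmx det1 !det_map_mx -rmorphM/= => /eqP.
rewrite -[1]/(1%:~R) eqr_int => /eqP detNM.
have /orP[/eqP ->|/eqP ->] : \det M \is a GRing.unit.
- by apply/unitrPr; exists (\det N); rewrite mulrC.
- by rewrite normr1.
- by rewrite rmorphN1 normrN1.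
Qed.

End bases.

(** * Root polytopes *)

Section polytopes.
Variables (R : realType) (n : nat).
Local Notation V := 'I_n.+1.
Implicit Types G H S T : {set V * V}.

(** Points in [conv_hull] may be repeated; grouping the weights by index leaves one weight per
    vertex. *)
Lemma conv_hull_range (m d : nat) (p : 'I_d -> 'rV[R]_m) (x : 'rV[R]_m) :
  conv_hull (range p) x <->
  exists c : 'I_d -> R, [/\ forall i, 0 <= c i, \sum_i c i = 1 & x = \sum_i c i *: p i].
Proof.
split=> [[k [q [c [qp c0 c1 ->]]]]|[c [c0 c1 ->]]]; last first.
  by exists d, p, c; split => // i; exists i.
have /choice[g gq] (i : 'I_k) : exists j, p j = q i.
  by have [j _ <-] := qp i; exists j.
exists (fun j => \sum_(i | g i == j) c i); split=> [j||].
- by rewrite sumr_ge0.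
- by rewrite -c1 [RHS](partition_big g xpredT).
- rewrite [LHS](partition_big g xpredT)//=; apply: eq_bigr => j _.
  by rewrite scaler_suml; apply: eq_bigr => i /eqP <-; rewrite gq.
Qed.

(* On the cone of an alternating graph the sum of the coordinates at the
   sources is the sum of the coefficients, and it is at most 1 on the roots. *)
Lemma full_root_polytope_le1 S (c : V * V -> R) : is_graph S -> Defs.alternating S ->
  (forall e, e \notin S -> c e = 0) -> full_root_polytope (comb c) ->
  \sum_e c e <= 1.
Proof.
move=> gS /alternatingP aS cS [d [p [b [pr b0 b1 xE]]]].
pose src v := [exists w, (v, w) \in S].
pose phi (y : 'rV[R]_n.+1) := \sum_(v | src v) y 0 v.
have phi_sum (I : finType) (a : I -> R) (q : I -> 'rV[R]_n.+1) :
    phi (\sum_i a i *: q i) = \sum_i a i * phi (q i).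
  rewrite /phi; under eq_bigr do rewrite summxE.
  rewrite exchange_big; apply: eq_bigr => i _; rewrite mulr_sumr.
  by apply: eq_bigr => v _; rewrite mxE.
have phi_root i j : phi (Defs.root R i j) = (src i)%:R - (src j)%:R.
  have phi1 k : \sum_(v | src v) ((k == v)%:R : R) = (src k)%:R.
    have [ks|/negP ks] := boolP (src k).
      by rewrite (bigD1 k)//= eqxx big1 ?addr0// => v /andP[_ /negPf]; rewrite eq_sym => ->.
    by rewrite big1// => v vs; case: eqP => // kv; rewrite kv vs in ks.
  by rewrite /phi; under eq_bigr do rewrite root_coord; rewrite sumrB !phi1.
have -> : \sum_e c e = phi (comb c).
  rewrite /comb phi_sum; apply: eq_bigr => -[i j] _.
  have [ijS|/cS ->] := boolP ((i, j) \in S); last by rewrite mul0r.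
  rewrite phi_root/=.
  have -> : src i by apply/existsP; exists j.
  have /negPf -> : ~~ src j.
    apply/existsP => -[k jkS]; move: (jkS); apply/negP/(aS i) => //.
      exact: graph_lt ijS.
    exact: graph_lt jkS.
  by rewrite subr0 mulr1.
rewrite xE phi_sum -b1; apply: ler_sum => i _; rewrite -[leRHS]mulr1 ler_wpM2l//.
have [->|[u [v [_ ->]]]] := pr i.
  by rewrite /phi big1// => v _; rewrite mxE.
by rewrite phi_root; case: (src u); case: (src v); rewrite /=; lra.
Qed.

Definition simplex_vertex k (e : 'I_k -> V * V) (i : 'I_k.+1) : 'rV[R]_n.+1 :=
  oapp (fun j => Defs.root R (e j).1 (e j).2) 0 (unlift ord0 i).

Lemma simplex_vertex0 k (e : 'I_k -> V * V) : simplex_vertex e ord0 = 0.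
Proof. by rewrite /simplex_vertex unlift_none. Qed.

Lemma simplex_vertexS k (e : 'I_k -> V * V) i :
  simplex_vertex e (lift ord0 i) = Defs.root R (e i).1 (e i).2.
Proof. by rewrite /simplex_vertex liftK. Qed.

Section na_basis_polytope.
Variable e : 'I_n -> V * V.
Hypothesis einj : injective e.
Let S := [set e i | i : 'I_n]%SET.
Hypotheses (gS : is_graph S) (ncS : noncrossing S) (aS : Defs.alternating S).

(** Within the cone, lying in the full root polytope means that the coefficients sum to at most 1;
    the slack is the weight of the origin. *)
Lemma na_polytope_conv : root_polytope R S = conv_hull (range (simplex_vertex e)).
Proof.
apply/seteqP; split=> x.
  move=> [+ /root_coneP[c [c0 cS xE]]]; rewrite xE.
  move=> /(full_root_polytope_le1 gS aS cS) c1; apply/conv_hull_range.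
  exists (fun i => oapp (fun j => c (e j)) (1 - \sum_f c f) (unlift ord0 i)).
  have cE : \sum_f c f = \sum_j c (e j).
    rewrite (bigID (mem S))/= [X in _ + X]big1 ?addr0 => [|f /cS//].
    by rewrite big_imset//= => i j _ _; exact: einj.
  split.
  - by move=> i; case: unliftP => [j _|_] /=; rewrite ?subr_ge0.
  - rewrite big_ord_recl unlift_none/= cE; under [X in _ + X]eq_bigr do rewrite liftK/=.
    by rewrite subrK.
  - rewrite big_ord_recl unlift_none/= simplex_vertex0 scaler0 add0r.
    by rewrite (comb_enum einj cS); apply: eq_bigr => i _; rewrite liftK/= simplex_vertexS.
move=> [d [p [c [pS c0 c1 ->]]]]; split.
  exists d, p, c; split=> // i; have [j _ <-] := pS i.
  have [k ->|->] := unliftP ord0 j; last by left; rewrite simplex_vertex0.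
  right; rewrite simplex_vertexS; exists (e k).1, (e k).2; split => //.
  by apply: (graph_lt gS); rewrite -surjective_pairing imset_f.
apply: big_ind => [||i _].
- exact: root_cone0.
- by move=> y z; exact: root_coneD.
- apply: root_coneZ => //; have [j _ <-] := pS i.
  have [k ->|->] := unliftP ord0 j.
    by rewrite simplex_vertexS; apply: root_cone_root; rewrite -surjective_pairing imset_f.
  by rewrite simplex_vertex0; exact: root_cone0.
Qed.

Lemma na_polytopeP (x : 'rV[R]_n.+1) : root_polytope R S x <->
  exists u : 'I_n -> R, [/\ forall i, 0 <= u i, \sum_i u i <= 1 &
    x = \sum_i u i *: Defs.root R (e i).1 (e i).2].
Proof.
rewrite na_polytope_conv; split.
  move=> /conv_hull_range[c [c0 + ->]]; rewrite !big_ord_recl => c1.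
  exists (fun i => c (lift ord0 i)); split => //; first by rewrite -c1 lerDr.
  rewrite simplex_vertex0 scaler0 add0r.
  by apply: eq_bigr => i _; rewrite simplex_vertexS.
move=> [u [u0 u1 ->]]; apply/conv_hull_range.
exists (fun i => oapp u (1 - \sum_j u j) (unlift ord0 i)); split.
- by move=> i; case: unliftP => [j _|_] /=; rewrite ?subr_ge0.
- rewrite big_ord_recl unlift_none/=; under [X in _ + X]eq_bigr do rewrite liftK/=.
  by rewrite subrK.
- rewrite big_ord_recl unlift_none/= simplex_vertex0 scaler0 add0r.
  by apply: eq_bigr => i _; rewrite liftK/= simplex_vertexS.
Qed.

Lemma roots_free (u : 'I_n -> R) :
  \sum_i u i *: Defs.root R (e i).1 (e i).2 = 0 -> forall i, u i = 0.
Proof.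
move=> uE i; suff /rowP/(_ i) : \row_i u i = 0 by rewrite !mxE.
apply: (basis_mx_free einj) => //; apply/rowP => j; rewrite [RHS]mxE.
move/rowP/(_ (lift ord_max j)) : uE; rewrite summxE [in X in _ = X -> _]mxE => uE.
by rewrite -[RHS]uE [LHS]mxE; apply: eq_bigr => k _; rewrite [in RHS]mxE !mxE.
Qed.

Lemma na_polytope_simplex : is_simplex n (root_polytope R S).
Proof.
exists (simplex_vertex e); split; last exact: na_polytope_conv.
move=> c; rewrite !big_ord_recl simplex_vertex0 scaler0 add0r => c0.
under eq_bigr do rewrite simplex_vertexS.
move=> /roots_free cS i; have [j ->//|->] := unliftP ord0 i.
by move: c0; rewrite big1 ?addr0.
Qed.

(** A short move from [x] against a root stays in the polytope, so the coefficient of that root is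
    at least some positive [t]. *)
Lemma relint_na_polytope (x : 'rV[R]_n.+1) : relint (root_polytope R S) x ->
  exists c : V * V -> R, [/\ forall f, 0 <= c f, forall f, f \notin S -> c f = 0,
    forall f, f \in S -> 0 < c f & x = comb c].
Proof.
move=> [Px nx]; have /na_polytopeP[u [u0 u1 xE]] := Px.
have [c [cS ce cE]] := enum_coef u einj.
exists c; split=> [f|//|_ /imsetP[i _ ->]|]; last by rewrite cE.
  by have [/imsetP[i _ ->]|/cS->//] := boolP (f \in S); rewrite ce.
rewrite ce.
have P0 : root_polytope R S 0.
  apply/na_polytopeP; exists (fun=> 0); split => //; first by rewrite big1.
  by rewrite big1// => j _; rewrite scale0r.
have Pi : root_polytope R S (Defs.root R (e i).1 (e i).2).
  apply/na_polytopeP; exists (fun j => (j == i)%:R); split => //.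
  - by rewrite (bigD1 i)//= eqxx big1 ?addr0// => j /negPf ->.
  - rewrite (bigD1 i)//= eqxx scale1r big1 ?addr0// => j /negPf ->.
    by rewrite scale0r.
pose y (t : R) := x - t *: Defs.root R (e i).1 (e i).2.
have yx : y t @[t --> 0^'+] --> x.
  have -> : x = y 0 by rewrite /y scale0r subr0.
  apply: cvg_at_right_filter; apply: cvgB; first exact: cvg_cst.
  exact: scalel_continuous.
have [t [t0 yt]] : exists t : R, 0 < t /\ (affine_hull (root_polytope R S) (y t) ->
    root_polytope R S (y t)).
  have /= H := yx _ nx.
  near (0 : R)^'+ => t; exists t; split; first by near: t; exact: nbhs_right_gt.
  by near: t.
have /yt/na_polytopeP[v [v0 v1 yE]] : affine_hull (root_polytope R S) (y t).
  (* The origin takes the weight [t], so that the weights 1, [- t], [t] sum to 1. *)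
  exists 3%N, (fun j : 'I_3 => nth 0 [:: x; Defs.root R (e i).1 (e i).2; 0] j),
    (fun j : 'I_3 => nth 0 [:: 1; - t; t] j); split.
  - by case=> -[|[|[|]]].
  - by rewrite !big_ord_recl big_ord0/=; ring.
  - by rewrite !big_ord_recl big_ord0/= scale1r scaler0 !addr0 scaleNr.
have : u i - t * (i == i)%:R - v i = 0.
  apply: (@roots_free (fun j => u j - t * (j == i)%:R - v j)).
  under eq_bigr do rewrite scalerBl scalerBl.
  rewrite sumrB sumrB -xE -yE /y (bigD1 i)//= eqxx mulr1 big1 ?addr0 ?subrr//.
  by move=> j /negPf ->; rewrite mulr0 scale0r.
by rewrite eqxx mulr1; have := v0 i; lra.
Unshelve. all: by end_near. Qed.

End na_basis_polytope.

End polytopes.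

(** * Volumes of the simplices and of their overlaps *)

Section volume.
Variables (R : realType) (n : nat).
Local Notation V := 'I_n.+1.
Local Notation rT := (measurableTypeR R).
Implicit Types G H S T : {set V * V}.

(** In these coordinates the incidence matrix carries the standard simplex to the root polytope. *)
Lemma chart_lin (e : 'I_n -> V * V) (u : n.-tuple R) :
  chart (lin (basis_mx R e) u) =
  \sum_i tnth u i *: Defs.root R (e i).1 (e i).2.
Proof.
apply: hyperplane_eq; first exact: chart_sum.
  have r0 (f : V * V) : \sum_j Defs.root R f.1 f.2 0 j = 0.
    by rewrite -comb_delta comb_sum0.
  under eq_bigr do rewrite summxE; rewrite exchange_big big1//= => i _.
  by under eq_bigr do rewrite mxE; rewrite -mulr_sumr r0 mulr0.
move=> j; rewrite chart_coord tnth_mktuple summxE.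
by apply: eq_bigr => i _; rewrite [RHS]mxE [in LHS]mxE.
Qed.

Section na_basis_volume.
Variable e : 'I_n -> V * V.
Hypothesis einj : injective e.
Let S := [set e i | i : 'I_n]%SET.
Hypotheses (gS : is_graph S) (ncS : noncrossing S) (aS : Defs.alternating S).
Hypothesis dete : `|\det (basis_mx R e)| = 1.

Let M := basis_mx R e.

Lemma basis_mx_unit : M \in unitmx.
Proof. by rewrite unitmxE unitfE -normr_eq0 dete oner_eq0. Qed.

Lemma det_basis_inv : `|\det (invmx M)| = 1.
Proof. by rewrite det_inv normfV dete invr1. Qed.

Lemma lin_basisK (t : n.-tuple rT) : lin M (lin (invmx M) t) = t.
Proof.
rewrite -[LHS]/((lin M \o lin (invmx M)) t) -lin_mul mulVmx ?basis_mx_unit//.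
exact: lin1.
Qed.

Lemma lin_invK (t : n.-tuple rT) : lin (invmx M) (lin M t) = t.
Proof.
rewrite -[LHS]/((lin (invmx M) \o lin M) t) -lin_mul mulmxV ?basis_mx_unit//.
exact: lin1.
Qed.

(** The inverse matrix appears because [preserving] concerns preimages. *)
Lemma chart_na_polytope :
  @chart R n @^-1` root_polytope R S = lin (invmx M) @^-1` corner n 1.
Proof.
apply/seteqP; split => t /=.
  move=> /(na_polytopeP einj gS aS)[u [u0 u1 tE]].
  have -> : t = lin M [tuple u i | i < n].
    apply: (@chart_inj R n); rewrite tE chart_lin.
    by apply: eq_bigr => i _; rewrite tnth_mktuple.
  rewrite lin_invK; split; first by move=> i; rewrite tnth_mktuple.
  by under eq_bigr do rewrite tnth_mktuple.
move=> [u0 u1]; apply/(na_polytopeP einj gS aS).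
exists (tnth (lin (invmx M) t)); split=> //.
by rewrite -chart_lin lin_basisK.
Qed.

Lemma measurable_chart_na_polytope :
  measurable (@chart R n @^-1` root_polytope R S : set (n.-tuple rT)).
Proof.
rewrite chart_na_polytope -[X in measurable X]setTI; apply: measurable_lin => //.
exact: measurable_corner.
Qed.

Lemma vol_na_polytope : vol (root_polytope R S) = (1 / n`!%:R)%:E.
Proof.
rewrite /vol chart_na_polytope.
have [_ ->] := leb_lin det_basis_inv; last exact: measurable_corner.
by rewrite -[X in (X / _)%:E](expr1n R n); exact: leb_corner.
Qed.

(* By uniqueness of the coefficients, a common point has coefficient 0 at
   every edge that is not common. *)
Lemma vol_na_polytopeI S' : is_graph S' -> noncrossing S' -> Defs.alternating S' ->
  measurable (@chart R n @^-1` root_polytope R S' : set (n.-tuple rT)) ->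
  ~~ (S \subset S') -> vol (root_polytope R S `&` root_polytope R S') = 0%E.
Proof.
move=> gS' ncS' aS' mS' /fintype.subsetPn[_ /imsetP[i _ ->] eiS'].
have mh : measurable ([set t | tnth t i = 0] : set (n.-tuple rT)).
  rewrite (_ : mkset _ = (@tnth n rT)^~ i @^-1` [set 0])//.
  by rewrite -[X in measurable X]setTI; exact: measurable_tnth.
have [ml pl] := leb_lin det_basis_inv.
apply: (@subset_measure0 _ _ _ _ _ (lin (invmx M) @^-1` [set t | tnth t i = 0])).
- by apply: measurableI => //; exact: measurable_chart_na_polytope.
- by rewrite -[X in measurable X]setTI; exact: ml.
- move=> t /= [] /(na_polytopeP einj gS aS)[u [u0 _ tE]].
  move=> [_ /root_coneP[c [c0 cS' cE]]].
  have tu : t = lin M [tuple u j | j < n].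
    apply: (@chart_inj R n); rewrite tE chart_lin.
    by apply: eq_bigr => j _; rewrite tnth_mktuple.
  rewrite tu lin_invK tnth_mktuple.
  have [d [dS de dE]] := enum_coef u einj.
  rewrite -de (na_comb_inj gS gS' aS ncS aS' ncS' _ c0 dS cS') ?cS'//.
  - move=> f; have [/imsetP[j _ ->]|/dS->//] := boolP (f \in S).
    by rewrite de.
  - by rewrite -cE tE.
- exact: etrans (pl _ mh) (leb_hyperplane R i).
Qed.

End na_basis_volume.
End volume.

(** * Assembly of the dissection and the volume formula *)

Theorem theorem1 (R : realType) (n : nat) (T : {set 'I_n.+1 * 'I_n.+1}) :
  (1 <= n)%N -> is_tree T -> noncrossing T ->
  [/\ forall S, S \in na_spanning_trees T -> is_simplex n (root_polytope R S),
      forall S1 S2, S1 \in na_spanning_trees T -> S2 \in na_spanning_trees T ->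
        S1 <> S2 ->
        relint (root_polytope R S1) `&` relint (root_polytope R S2) = set0,
      \bigcup_(S in [set S | S \in na_spanning_trees T]) root_polytope R S =
        root_polytope R T
    & vol (root_polytope R T) =
        (#|na_spanning_trees T|%:R * (1 / n`!%:R))%:E].
Proof.
move=> _ /and3P[gT cT _] ncT.
have naP S : S \in na_spanning_trees T -> [/\ is_graph S, noncrossing S,
    Defs.alternating S & exists e : 'I_n -> 'I_n.+1 * 'I_n.+1,
      [/\ injective e, S = [set e i | i : 'I_n]%SET & `|\det (basis_mx R e)| = 1]].
  rewrite inE => /and3P[/andP[/and3P[gS cS _] _] ncS aS]; split => //.
  exact: na_basis.
have bigcupT : \bigcup_(S in [set S | S \in na_spanning_trees T]) root_polytope R S =
    root_polytope R T.
  apply/seteqP; split => [x [S /= ST] [xA xS]|x [xA xT]].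
    split => //; apply: root_cone_tclosure; move: xS; apply: root_cone_sub => i j ijS.
    move: ST; rewrite inE => /and3P[/andP[_ /fintype.subsetP ST] _ _].
    by apply: root_cone_root; exact: ST.
  (* The covering graph is only known to be connected; [na_acyclic] makes it a tree. *)
  have [S [[gS cS ncS aS] [ST xS]]] := na_cover gT cT ncT (sub_tclosure T)
    (@tclosure_trans _ T) xT.
  exists S => //=; rewrite inE ncS aS !andbT; apply/andP; split => //.
  by apply/and3P; split => //; exact: na_acyclic.
split => //.
- by move=> S /naP[gS ncS aS [e [ei SE _]]]; subst S; exact: na_polytope_simplex.
(* At a common interior point all coefficients on [S1] are positive, and by uniqueness they vanish
   off [S2]; exchanging the two trees gives equality. *)
- suff sub S1 S2 x : S1 \in na_spanning_trees T -> S2 \in na_spanning_trees T ->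
      relint (root_polytope R S1) x -> relint (root_polytope R S2) x -> S1 \subset S2.
    move=> S1 S2 S1T S2T S12; apply/seteqP; split => // x [x1 x2]; apply: S12.
    by apply/eqP; rewrite finset.eqEsubset (sub S1 S2 x)// (sub S2 S1 x).
  move=> /naP[g1 nc1 a1 [e1 [e1i S1E _]]] /naP[g2 nc2 a2 [e2 [e2i S2E _]]].
  rewrite S1E in g1 nc1 a1 *; rewrite S2E in g2 nc2 a2 *.
  move=> /(relint_na_polytope e1i g1 nc1 a1)[c1 [c10 c1S c1p ->]].
  move=> /(relint_na_polytope e2i g2 nc2 a2)[c2 [c20 c2S _ c12]].
  have c12E := na_comb_inj g1 g2 a1 nc1 a2 nc2 c10 c20 c1S c2S c12.
  apply/fintype.subsetP => f /c1p; rewrite c12E.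
  by apply: contraTT => /c2S ->; rewrite ltxx.
- pose P S := @chart R n @^-1` root_polytope R S : set (n.-tuple (measurableTypeR R)).
  rewrite -bigcupT /vol preimage_bigcup.
  rewrite (_ : \bigcup_(S in _) _ = \big[setU/set0]_(S <- enum (na_spanning_trees T)) P S);
    last first.
    rewrite -bigcup_seq; apply: eq_bigcup => //.
    by split => S /=; rewrite mem_enum.
  rewrite (measure_bigsetU_null (v := 1 / n`!%:R)) -?cardE//.
  + exact: enum_uniq.
  + move=> S; rewrite mem_enum => /naP[gS ncS aS [e [ei SE dete]]]; subst S.
    exact: measurable_chart_na_polytope.
  + move=> S; rewrite mem_enum => /naP[gS ncS aS [e [ei SE dete]]]; subst S.
    exact: vol_na_polytope.
  + move=> S1 S2; rewrite !mem_enum => S1T S2T S12.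
    have [g1 nc1 a1 [e1 [e1i S1E det1]]] := naP _ S1T.
    have [g2 nc2 a2 [e2 [e2i S2E det2]]] := naP _ S2T.
    have m1 : measurable (P S1).
      by rewrite S1E in g1 nc1 a1 *; exact: measurable_chart_na_polytope.
    have m2 : measurable (P S2).
      by rewrite S2E in g2 nc2 a2 *; exact: measurable_chart_na_polytope.
    rewrite /P -preimage_setI -/(vol _).
    (* Distinct trees fail at least one of the two inclusions, and the null overlap is obtained from
       that side. *)
    have [S12s|S12s] := boolP (S1 \subset S2); last first.
      by rewrite S1E in g1 nc1 a1 S12s *; exact: vol_na_polytopeI.
    rewrite setIC; rewrite S2E in g2 nc2 a2 *; apply: vol_na_polytopeI => //.
    by apply: contraNN S12 => S21s; rewrite finset.eqEsubset S12s S2E.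
Qed.
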